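(* Write $\llbracket r\rrbracket=\frac{v^r-v^{-r}}{v-v^{-1}}$. In the convolution algebra $\mathbf S^{\jmath}$ (products are convolution products) the elements $\mathbf e_i,\mathbf f_i$ $(i\in[1,n])$ and $\mathbf d_a^{\pm1}$ $(a\in[1,n+1])$ satisfy, for all $i,j\in[1,n]$: $$\mathbf d_i\mathbf d_i^{-1}=\mathbf d_i^{-1}\mathbf d_i=1,\qquad \mathbf d_i\mathbf d_j=\mathbf d_j\mathbf d_i,$$ $$\mathbf d_i\mathbf e_j\mathbf d_i^{-1}=v^{\delta_{i,j}-\delta_{i,j+1}}\mathbf e_j,\qquad \mathbf d_i\mathbf f_j\mathbf d_i^{-1}=v^{-\delta_{i,j}+\delta_{i,j+1}}\mathbf f_j,$$ $$\mathbf e_i\mathbf f_j-\mathbf f_j\mathbf e_i=\delta_{i,j}\frac{\mathbf d_i\mathbf d_{i+1}^{-1}-\mathbf d_i^{-1}\mathbf d_{i+1}}{v-v^{-1}}\quad\text{if } i,j\ne n,$$ $$\mathbf e_i^2\mathbf e_j+\mathbf e_j\mathbf e_i^2=\llbracket2\rrbracket\mathbf e_i\mathbf e_j\mathbf e_i,\qquad \mathbf f_i^2\mathbf f_j+\mathbf f_j\mathbf f_i^2=\llbracket2\rrbracket\mathbf f_i\mathbf f_j\mathbf f_i\quad\text{if }|i-j|=1,$$ $$\mathbf e_i\mathbf e_j=\mathbf e_j\mathbf e_i,\qquad \mathbf f_i\mathbf f_j=\mathbf f_j\mathbf f_i\quad\text{if }|i-j|>1,$$ $$\mathbf d_{n+1}\mathbf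 d_i=\mathbf d_i\mathbf d_{n+1},\qquad \mathbf d_{n+1}\mathbf d_{n+1}^{-1}=\mathbf d_{n+1}^{-1}\mathbf d_{n+1}=1,$$ $$\mathbf d_{n+1}\mathbf e_i\mathbf d_{n+1}^{-1}=v^{-2\delta_{n,i}}\mathbf e_i,\qquad \mathbf d_{n+1}\mathbf f_i\mathbf d_{n+1}^{-1}=v^{2\delta_{n,i}}\mathbf f_i,$$ $$\mathbf e_n^2\mathbf f_n+\mathbf f_n\mathbf e_n^2=\llbracket2\rrbracket\Big(\mathbf e_n\mathbf f_n\mathbf e_n-\mathbf e_n\big(v\,\mathbf d_n\mathbf d_{n+1}^{-1}+v^{-1}\mathbf d_n^{-1}\mathbf d_{n+1}\big)\Big),$$ $$\mathbf f_n^2\mathbf e_n+\mathbf e_n\mathbf f_n^2=\llbracket2\rrbracket\Big(\mathbf f_n\mathbf e_n\mathbf f_n-\big(v\,\mathbf d_n\mathbf d_{n+1}^{-1}+v^{-1}\mathbf d_n^{-1}\mathbf d_{n+1}\big)\mathbf f_n\Big).$$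
   Context: Let $\mathcal A=\mathbb Z[v,v^{-1}]$, $n,d\ge1$, $N=2n+1$, $D=2d+1$; $[a,b]$ denotes the set of integers from $a$ to $b$, $\mathbb N=\{0,1,2,\dots\}$, and $|U|=\dim U$. For an odd prime power $q$ equip $\mathbb F_q^D$ with a nondegenerate symmetric bilinear form with isometry group $O(D)$, and let $X$ be the set of flags $V=(0=V_0\subseteq V_1\subseteq\cdots\subseteq V_N=\mathbb F_q^D)$ with $V_i=V_{N-i}^\perp$ for all $i$. Let $\Xi_d$ be the set of $N\times N$ matrices $A=(a_{ij})$ over $\mathbb N$ with $\sum a_{ij}=D$ and $a_{ij}=a_{N+1-i,N+1-j}$. The $O(D)$-orbits $\mathcal O_A$ on $X\times X$ are indexed by $A\in\Xi_d$: $(V,V')\in\mathcal O_A$ iff $a_{ij}=|(V_{i-1}+V_i\cap V'_j)/(V_{i-1}+V_i\cap V'_{j-1})|$ for all $i,j$. $\mathbf S^{\jmath}$ is the $\mathcal A$-module of $\mathcal A$-valued $O(D)$-invariant functions on $X\times X$, free with basis the characteristic functions $e_A$ of $\mathcal O_A$ ($A\in\Xi_d$; the parametrization does not depend on $q$), with product $e_A*e_{A'}=\sum_{A''}g_{A,A',A''}e_{A''}$, where $g_{A,A',A''}\in\mathbb Z[v^2]$ is the polynomial whose value at $v=\sqrt q$, for every odd prime power $q$, is the number of $V\in X$ with $(V_1,V)\in\mathcal O_A$, $(V,V_2)\in\mathcal O_{A'}$, for any fixed $(V_1,V_2)\in\mathcal O_{A''}$. Write $U\overset{1}{\subset}W$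 if $U\subset W$ has codimension 1. For $i\in[1,n]$, $a\in[1,n+1]$ and $V,V'\in X$: $\mathbf e_i(V,V')=v^{-|V'_{i+1}/V'_i|}$ if $V_i\overset1\subset V'_i$ and $V_j=V'_j$ for all $j\in[1,n]\setminus\{i\}$, and $0$ otherwise; $\mathbf f_i(V,V')=v^{-|V'_i/V'_{i-1}|}$ if $V'_i\overset1\subset V_i$ and $V_j=V'_j$ for all $j\in[1,n]\setminus\{i\}$, and $0$ otherwise; $\mathbf d_a^{\pm1}(V,V')=v^{\mp|V'_a/V'_{a-1}|}$ if $V=V'$, and $0$ otherwise. *)

(* Defs.v *)
From HB Require Import structures.
From mathcomp Require Import all_boot all_order all_algebra all_fingroup.
From mathcomp Require Import boolp.

Set Implicit Arguments.
Unset Strict Implicit.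
Unset Printing Implicit Defensive.

Import GRing.Theory.
Local Open Scope ring_scope.

(* The ring A = Z[v, v^-1], as the subring of the fractions of Z['X] whose
   denominator is a power of v = 'X. *)
Definition Qv := {fraction {poly int}}.
HB.instance Definition _ := GRing.Field.on Qv.

Definition vQ : Qv := tofrac ('X : {poly int}).

Definition laurent : {pred Qv} :=
  fun x => `[< exists (k : nat) (p : {poly int}), x * vQ ^+ k = tofrac p >].

Lemma laurentP x :
  reflect (exists (k : nat) (p : {poly int}), x * vQ ^+ k = tofrac p)
          (x \in laurent).
Proof. exact: asboolP. Qed.

Lemma laurent_subring : subring_closed laurent.
Proof.
split.
- by apply/laurentP; exists 0%N, 1; rewrite expr0 mulr1 tofrac1.
- move=> x y /laurentP[k [p hp]] /laurentP[l [r hr]]; apply/laurentP.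
  exists (k + l)%N, (p * 'X^l - r * 'X^k).
  rewrite tofracB !tofracM !tofracXn -hp -hr -/vQ exprD mulrBl !mulrA.
  by congr (_ - _); rewrite -!mulrA [vQ ^+ k * _]mulrC.
- move=> x y /laurentP[k [p hp]] /laurentP[l [r hr]]; apply/laurentP.
  by exists (k + l)%N, (p * r); rewrite tofracM -hp -hr exprD mulrACA.
Qed.

HB.instance Definition _ := GRing.isSubringClosed.Build Qv laurent laurent_subring.

Record Laurent := MkLaurent { laurent_val : Qv; _ : laurent_val \in laurent }.
HB.instance Definition _ := [isSub for laurent_val].
HB.instance Definition _ := [Choice of Laurent by <:].
HB.instance Definition _ := [SubChoice_isSubComNzRing of Laurent by <:].

Lemma vQ_neq0 : vQ != 0.
Proof. by rewrite /vQ tofrac_eq0 polyX_eq0. Qed.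

Lemma laurent_poly (p : {poly int}) : tofrac p \in laurent.
Proof. by apply/laurentP; exists 0%N, p; rewrite expr0 mulr1. Qed.

Lemma laurent_vpow (z : int) : vQ ^ z \in laurent.
Proof.
case: z => n; first by rewrite -exprnP /vQ -tofracXn laurent_poly.
apply/laurentP; exists n.+1, 1.
by rewrite NegzE -exprnN mulVf ?expf_neq0 ?vQ_neq0 // tofrac1.
Qed.

Definition vpow (z : int) : Laurent := MkLaurent (laurent_vpow z).

Lemma laurent_qint (r : nat) :
  (vQ ^ r%:Z - vQ ^ (- r%:Z)) / (vQ - vQ ^ (-1)) \in laurent.
Proof.
have [-> | nz] := eqVneq (vQ - vQ ^ (-1)) 0.
  by rewrite invr0 mulr0 -tofrac0 laurent_poly.
rewrite -exprnN -exprVn -exprnP exprN1 subrXX mulrC mulKf -?exprN1 //.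
apply: rpred_sum => i _; rewrite exprN1 exprVn exprnN.
by apply: rpredM; [apply: (laurent_vpow (Posz _)) | apply: laurent_vpow].
Qed.

(* The quantum integer [[r]]; the quotient is taken in Q(v) and lies in A. *)
Definition qint (r : nat) : Laurent := MkLaurent (laurent_qint r).

(* p : {poly int}, a polynomial in the indeterminate q, seen in Z[v^2] by
   substituting v^2 for q. *)
Definition at_v2 (p : {poly int}) : Laurent := MkLaurent (laurent_poly (p \Po 'X^2)).

Section FiniteVspace.
Import VectorInternalTheory.
Variables (F : finFieldType) (vT : vectType F).
HB.instance Definition _ := [Countable of {vspace vT} by <:].
HB.instance Definition _ := [Finite of {vspace vT} by <:].
End FiniteVspace.

Definition Ndim (n : nat) : nat := (2 * n).+1.

(* rev_ord encodes i |-> N + 1 - i on the (0-based) indices 'I_N. *)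
Definition is_Xi (n d : nat) (A : 'M[nat]_(Ndim n)) : bool :=
  ((\sum_i \sum_j A i j)%N == Ndim d)
  && [forall i, forall j, A i j == A (rev_ord i) (rev_ord j)].

Record Xi (n d : nat) := MkXi { Xi_mx : 'M[nat]_(Ndim n); _ : is_Xi d Xi_mx }.
HB.instance Definition _ n d := [isSub for @Xi_mx n d].
HB.instance Definition _ n d := [Choice of Xi n d by <:].

Section XiFinite.
Variables n d : nat.

Lemma Xi_bound (A : Xi n d) i j : (Xi_mx A i j < (Ndim d).+1)%N.
Proof.
case: A => A /= /andP[/eqP <- _]; rewrite ltnS.
by rewrite (bigD1 i) //= (bigD1 j) //= -addnA leq_addr.
Qed.

Definition Xi_code (A : Xi n d) : 'M['I_(Ndim d).+1]_(Ndim n) :=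
  \matrix_(i, j) Ordinal (Xi_bound A i j).
Definition Xi_decode (C : 'M['I_(Ndim d).+1]_(Ndim n)) : option (Xi n d) :=
  insub (map_mx (@nat_of_ord _) C).
Lemma Xi_codeK : pcancel Xi_code Xi_decode.
Proof.
move=> A; rewrite /Xi_decode (_ : map_mx _ _ = val A) ?valK //.
by apply/matrixP => i j; rewrite !mxE.
Qed.
HB.instance Definition _ := [Countable of Xi n d by <:].
HB.instance Definition _ : isFinite (Xi n d) := PCanIsFinite Xi_codeK.
End XiFinite.

Section Flags.
Variables (n d : nat) (F : finFieldType).
Local Notation U := 'rV[F]_(Ndim d).
Variable B : {symmetric U}.

Definition is_flag (V : {ffun 'I_(Ndim n).+1 -> {vspace U}}) : bool :=
  [&& V ord0 == 0%VS, V ord_max == fullv,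
      [forall i : 'I_(Ndim n).+1, forall j : 'I_(Ndim n).+1, (i <= j)%N ==> (V i <= V j)%VS]
    & [forall i, V i == orthov B (V (rev_ord i))]].

Record flag := MkFlag
  { flag_val : {ffun 'I_(Ndim n).+1 -> {vspace U}}; _ : is_flag flag_val }.
HB.instance Definition _ := [isSub for flag_val].
HB.instance Definition _ := [Finite of flag by <:].

(* V_k; inord makes this meaningful only for k <= N. *)
Definition Vpart (V : flag) (k : nat) : {vspace U} := flag_val V (inord k).

(* |V_k / V_(k-1)| *)
Definition gap (V : flag) (k : nat) : nat := (\dim (Vpart V k) - \dim (Vpart V k.-1))%N.

(* The index i : 'I_N is 0-based: it stands for i + 1 in [1, N]. *)
Definition relpos (V V' : flag) : 'M[nat]_(Ndim n) :=
  \matrix_(i, j)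
    (\dim (Vpart V i + (Vpart V i.+1 :&: Vpart V' j.+1))%VS
     - \dim (Vpart V i + (Vpart V i.+1 :&: Vpart V' j))%VS)%N.

Definition Orb (A : Xi n d) : {set flag * flag} :=
  [set p | relpos p.1 p.2 == Xi_mx A].

Definition GLmx (g : {'GL_(Ndim d)[F]}) : 'M[F]_(Ndim d) := GLval g.

Definition OD : {set {'GL_(Ndim d)[F]}} :=
  [set g : {'GL_(Ndim d)[F]} | [forall u : U, forall w : U,
     B (u *m GLmx g) (w *m GLmx g) == B u w]].

Definition moves (g : {'GL_(Ndim d)[F]}) (V W : flag) : bool :=
  [forall i, flag_val W i == (linfun (mulmxr (GLmx g)) @: flag_val V i)%VS].

Definition funXX := {ffun flag * flag -> Laurent^o}.
HB.instance Definition _ := GRing.Lmodule.on funXX.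

Definition OD_inv : {pred funXX} := fun f =>
  [forall g in OD, forall V, forall V', forall W, forall W',
    moves g V W && moves g V' W' ==> (f (W, W') == f (V, V'))].

Lemma invariantP (f : funXX) :
  reflect (forall g V V' W W', g \in OD -> moves g V W -> moves g V' W' ->
             f (W, W') = f (V, V')) (f \in OD_inv).
Proof.
apply: (iffP 'forall_implyP) => [H g V V' W W' hg h1 h2 | H g hg].
  move/(_ g hg): H => /forallP/(_ V)/forallP/(_ V')/forallP/(_ W)/forallP/(_ W').
  by rewrite h1 h2 => /eqP.
apply/forallP => V; apply/forallP => V'; apply/forallP => W; apply/forallP => W'.
by apply/implyP => /andP[h1 h2]; apply/eqP; apply: H h1 h2.
Qed.

Lemma invariant_submod : submod_closed OD_inv.
Proof.
split; first by apply/invariantP => *; rewrite !ffunE.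
move=> a f h /invariantP hf /invariantP hh; apply/invariantP => g V V' W W' hg h1 h2.
by rewrite !ffunE (hf g V V' W W') // (hh g V V' W W').
Qed.
HB.instance Definition _ :=
  GRing.isSubmodClosed.Build Laurent funXX OD_inv invariant_submod.

Record Sj := MkSj { Sj_val : funXX; _ : Sj_val \in OD_inv }.
HB.instance Definition _ := [isSub for Sj_val].
HB.instance Definition _ := [Choice of Sj by <:].
HB.instance Definition _ := [SubChoice_isSubLmodule of Sj by <:].

Section Moves.
Variables (g : {'GL_(Ndim d)[F]}).

Lemma lker_GL : lker (linfun (mulmxr (GLmx g)) : 'Hom(U, U)) == 0%VS.
Proof.
apply/lker0P => x y; rewrite !lfunE /=.
by apply: (can_inj (mulmxK _)); apply: (valP g).
Qed.

Lemma moves_part V W k : moves g V W ->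
  Vpart W k = (linfun (mulmxr (GLmx g)) @: Vpart V k)%VS.
Proof. by move/forallP/(_ (inord k))/eqP. Qed.

Lemma dim_GL (S : {vspace U}) :
  \dim (linfun (mulmxr (GLmx g)) @: S)%VS = \dim S.
Proof. by rewrite limg_dim_eq // (eqP lker_GL) capv0. Qed.

Lemma moves_gap V W k : moves g V W -> gap W k = gap V k.
Proof. by move=> h; rewrite /gap !(moves_part _ h) !dim_GL. Qed.

Lemma moves_relpos V V' W W' : moves g V W -> moves g V' W' ->
  relpos W W' = relpos V V'.
Proof.
move=> h1 h2; apply/matrixP => i j; rewrite !mxE !(moves_part _ h1) !(moves_part _ h2).
by rewrite -!lker0_img_cap ?lker_GL // -!limgD !dim_GL.
Qed.

Lemma moves_le V V' W W' k : moves g V W -> moves g V' W' ->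
  (Vpart W k <= Vpart W' k)%VS = (Vpart V k <= Vpart V' k)%VS.
Proof. by move=> h1 h2; rewrite (moves_part _ h1) (moves_part _ h2) limg_ker0 ?lker_GL. Qed.

Lemma moves_eq V V' W W' k : moves g V W -> moves g V' W' ->
  (Vpart W k == Vpart W' k) = (Vpart V k == Vpart V' k).
Proof. by move=> h1 h2; rewrite (moves_part _ h1) (moves_part _ h2) eq_limg_ker0 ?lker_GL. Qed.

Lemma moves_dim V W k : moves g V W -> \dim (Vpart W k) = \dim (Vpart V k).
Proof. by move=> h; rewrite (moves_part _ h) dim_GL. Qed.

Lemma moves_eqflag V V' W W' : moves g V W -> moves g V' W' ->
  (W == W') = (V == V').
Proof.
move=> /forallP h1 /forallP h2; apply/eqP/eqP => [E | E].
  apply: val_inj; apply/ffunP => i; apply/eqP.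
  rewrite -(eq_limg_ker0 _ _ lker_GL) -(eqP (h1 i)) -(eqP (h2 i)).
  by rewrite E.
by apply: val_inj; apply/ffunP => i; rewrite (eqP (h1 i)) (eqP (h2 i)) E.
Qed.
End Moves.

Definition codim1 (S T : {vspace U}) : bool :=
  (S <= T)%VS && (\dim T == (\dim S).+1).

(* V_j = V'_j for all j in [1, n] different from i. *)
Definition agree_off (i : nat) (V V' : flag) : bool :=
  [forall j : 'I_n.+1, (0 < j)%N && (j != i :> nat) ==> (Vpart V j == Vpart V' j)].

Lemma codim1_moves g V V' W W' k : moves g V W -> moves g V' W' ->
  codim1 (Vpart W k) (Vpart W' k) = codim1 (Vpart V k) (Vpart V' k).
Proof.
by move=> h1 h2; rewrite /codim1 (moves_le _ h1 h2) (moves_dim _ h1) (moves_dim _ h2).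
Qed.

Lemma agree_off_moves g i V V' W W' : moves g V W -> moves g V' W' ->
  agree_off i W W' = agree_off i V V'.
Proof.
by move=> h1 h2; apply: eq_forallb => j; rewrite (moves_eq _ h1 h2).
Qed.

Definition char_fun (A : Xi n d) : funXX :=
  [ffun p => (p \in Orb A)%:R].
Lemma char_invariant A : char_fun A \in OD_inv.
Proof.
apply/invariantP => g V V' W W' _ h1 h2.
by rewrite !ffunE !inE /= (moves_relpos h1 h2).
Qed.
Definition charS A : Sj := MkSj (char_invariant A).

(* The identity of the convolution algebra. *)
Definition one_fun : funXX := [ffun p => (p.1 == p.2)%:R].
Lemma one_invariant : one_fun \in OD_inv.
Proof.
apply/invariantP => g V V' W W' _ h1 h2.
by rewrite !ffunE /= (moves_eqflag h1 h2).
Qed.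
Definition oneS : Sj := MkSj one_invariant.

Definition e_fun (i : nat) : funXX := [ffun p =>
  if codim1 (Vpart p.1 i) (Vpart p.2 i) && agree_off i p.1 p.2
  then vpow (- (gap p.2 i.+1)%:Z) else 0].
Lemma e_invariant i : e_fun i \in OD_inv.
Proof.
apply/invariantP => g V V' W W' _ h1 h2; rewrite !ffunE /=.
by rewrite (codim1_moves _ h1 h2) (agree_off_moves _ h1 h2) (moves_gap _ h2).
Qed.
Definition eS i : Sj := MkSj (e_invariant i).

Definition f_fun (i : nat) : funXX := [ffun p =>
  if codim1 (Vpart p.2 i) (Vpart p.1 i) && agree_off i p.1 p.2
  then vpow (- (gap p.2 i)%:Z) else 0].
Lemma f_invariant i : f_fun i \in OD_inv.
Proof.
apply/invariantP => g V V' W W' _ h1 h2; rewrite !ffunE /=.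
by rewrite (codim1_moves _ h2 h1) (agree_off_moves _ h1 h2) (moves_gap _ h2).
Qed.
Definition fS i : Sj := MkSj (f_invariant i).

Definition d_fun (sgn : int) (a : nat) : funXX := [ffun p =>
  if p.1 == p.2 then vpow (- sgn * (gap p.2 a)%:Z) else 0].
Lemma d_invariant sgn a : d_fun sgn a \in OD_inv.
Proof.
apply/invariantP => g V V' W W' _ h1 h2; rewrite !ffunE /=.
by rewrite (moves_eqflag h1 h2) (moves_gap _ h2).
Qed.
Definition dS a : Sj := MkSj (d_invariant 1 a).
Definition dinvS a : Sj := MkSj (d_invariant (-1) a).

(* The coordinate of an OD_inv function on e_A: its value on O_A. *)
Definition coef_e (f : Sj) (A : Xi n d) : Laurent :=
  if [pick p in Orb A] is Some p then Sj_val f p else 0.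

(* The A-bilinear product with e_A * e_A' = \sum_A'' g_(A, A', A'') e_A''. *)
Definition conv (g : Xi n d -> Xi n d -> Xi n d -> {poly int}) (f h : Sj) : Sj :=
  \sum_(A : Xi n d) \sum_(A' : Xi n d) (coef_e f A * coef_e h A') *:
    \sum_(A'' : Xi n d) at_v2 (g A A' A'') *: charS A''.

End Flags.

(* g_(A, A', A'') is given as a polynomial in q = v^2. *)
Definition structure_polynomials (n d : nat)
    (g : Xi n d -> Xi n d -> Xi n d -> {poly int}) : Prop :=
  forall (F : finFieldType) (B : {symmetric 'rV[F]_(Ndim d)}),
    odd #|F| -> nondegenerate B ->
  forall (A A' A'' : Xi n d) (V1 V2 : flag n B), (V1, V2) \in Orb B A'' ->
    (g A A' A'').[#|F|%:R]
      = #|[set V | ((V1, V) \in Orb B A) && ((V, V2) \in Orb B A')]|%:R.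

Notation "x *[ g ] y" := (conv g x y)
  (at level 40, g at level 200, left associativity, format "x  *[ g ]  y").

(* Main.v *)
(* The structure constants are polynomials in v^2, and a Laurent polynomial that
   vanishes at v = p for every odd prime p is 0.  Each relation therefore only has
   to be checked over fields with p^2 elements, at v = p, for honest convolution
   of functions on pairs of flags, that is, for products of matrices indexed by
   flags.  There e_i = E_i d_(i+1) and f_i = E_i^T d_i, where E_i is the 0/1 matrix
   of the relation: V' enlarges V by one dimension at the i-th place.  Moving the
   diagonal matrices to the right turns each relation into an identity between
   numbers of paths of flags, which is a count of lines, hyperplanes or isotropic
   lines.  The key identity at the last node is I(m + 2) = 1 + q I(m) + q^m for the
   number I(m) of isotropic lines of a nondegenerate quadratic space of odd
   dimension m. *)

From HB Require Import structures.
Require Import Defs.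
From mathcomp Require Import all_boot all_order all_algebra all_fingroup.
From mathcomp Require Import cyclic finfield boolp ring zify.

Set Implicit Arguments.
Unset Strict Implicit.
Unset Printing Implicit Defensive.

Import GRing.Theory Num.Theory.
Local Open Scope ring_scope.

(* Some types of [\dim] carry the identity [reverse_coercion], which would make
   equal dimensions distinct atoms for [lia]. *)
Ltac dimlia := unfold reverse_coercion; clear; lia.

(** The product on [Sj n B] keeps [v] formal while [F] is fixed, so counting over this one field
    settles nothing. Other fields can be used because functions on pairs of flags are replaced by
    their coordinates on the orbits, indexed by [Xi n d] whatever the field, and because each
    generator depends on the relative position alone. With [#|F| = p ^ 2] the value of [v] is
    rational and no square root has to be adjoined. The obstacle is that coordinates are visible
    only on nonempty orbits: [coef_e] returns 0 on an empty one, and a specialization sees only the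
    positions that occur. For the antidiagonal form, coordinate subspaces realize every matrix of
    [Xi n d]. For an arbitrary form no classification is invoked: the structure polynomials give
    equal counts for both forms, and this carries orbits from one to the other. The last node is
    special because [V_(n+1)] is the orthogonal of [V_n]: two isotropic spaces sharing a hyperplane
    may have a sum that is not isotropic, so the argument for the commutator of [e_i] and [f_i]
    breaks down and a cubic relation takes its place. *)

Lemma expn_sub_transverse q K a : (1 < q)%N -> (a.+1 <= K - a.+1)%N ->
  (q ^ (K - a) - q ^ (K - a.+1) = q ^ (K - a.+1 - a.+1) * (q.-1 * q ^ a * q))%N.
Proof.
move=> q1 aK; have -> : (K - a = (K - a.+1).+1)%N by move: aK; dimlia.
rewrite expnS; have -> : (q ^ (K - a.+1) = q ^ (K - a.+1 - a.+1) * q ^ a.+1)%N.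
  by rewrite -expnD subnK.
rewrite -[X in (_ - X)%N]mul1n -mulnBl subn1 expnSr; ring.
Qed.

(** * Counting subspaces *)

Section Counting.
Variables (d : nat) (F : finFieldType).
Local Notation U := 'rV[F]_(Ndim d).
Implicit Types (A C S T : {vspace U}) (x : U).

Lemma card_vspace_row S : #|S| = (#|F| ^ \dim S)%N.
Proof. exact: card_vspace. Qed.

Lemma codim1_addv A x : x \notin A -> codim1 A (A + <[x]>)%VS.
Proof.
move=> xA; rewrite /codim1 addvSl /= dimv_disjoint_sum.
  by rewrite dim_vline (_ : x != 0) ?addn1 //; apply: contraNneq xA => ->; rewrite mem0v.
apply/eqP; rewrite -subv0; apply/subvP => y; rewrite memv_cap => /andP[yA /vlineP[k yk]].
have [k0|k0] := eqVneq k 0; first by rewrite yk k0 scale0r mem0v.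
by case/negP: xA; rewrite -[x](scalerK k0) -yk memvZ.
Qed.

Lemma codim1_sub A S : codim1 A S -> (A <= S)%VS.
Proof. by case/andP. Qed.

Lemma codim1_dim A S : codim1 A S -> \dim S = (\dim A).+1.
Proof. by case/andP => _ /eqP. Qed.

Lemma codim1_addvE A S x : codim1 A S -> x \notin A -> (x \in S) = ((A + <[x]>)%VS == S).
Proof.
move=> AS xA; apply/idP/eqP => [xS | <-]; last first.
  by rewrite memvE addvSr.
have AxS : (A + <[x]> <= S)%VS by rewrite subv_add codim1_sub //= -memvE.
apply/eqP; rewrite -(geq_leqif (dimv_leqif_eq AxS)).
by rewrite (codim1_dim (codim1_addv xA)) (codim1_dim AS).
Qed.

(* Both sides count pairs (S, x) with x in S but not in A, since S is A + <[x]>. *)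
Lemma card_overspaces A (P : pred {vspace U}) (X : pred U) :
    (forall S, P S -> codim1 A S) ->
    (forall x, X x = (x \notin A) && P (A + <[x]>)%VS) ->
  #|X| = (#|[set S | P S]| * (#|F|.-1 * #|F| ^ \dim A))%N.
Proof.
move=> hP hX.
rewrite -[LHS]sum1_card (partition_big (fun x => A + <[x]>)%VS P) /=; last first.
  by move=> x; rewrite unfold_in hX => /andP[].
rewrite -sum_nat_const big_set /=; apply: eq_bigr => S PS.
have AS := hP _ PS.
rewrite -subn1 mulnBl mul1n -expnS -(codim1_dim AS) -!card_vspace_row.
rewrite sum1_card -(cardID (mem A) (mem S)) -[X in (X + _ - _)%N](_ : #|A| = _).
  rewrite addKn; apply: eq_card => x; change (X x && ((A + <[x]>)%VS == S) = (x \notin A) && (x \in S)); rewrite hX.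
  by case xA: (x \in A) => //=; rewrite (codim1_addvE AS) ?xA //; case: eqP => [->|]; rewrite ?andbF ?andbT.
by apply: eq_card => x; rewrite !inE andb_idl //; apply/subvP/codim1_sub.
Qed.

(** These are the lines of [C / A], obtained from [card_overspaces] applied to the vectors of [C]
    outside [A]. The shape [N * (q - 1) + 1 = q ^ m] avoids division and truncated subtraction. *)
Lemma card_lines A C : (A <= C)%VS ->
  (#|[set S | codim1 A S && (S <= C)%VS]| * #|F|.-1).+1%N = (#|F| ^ (\dim C - \dim A))%N.
Proof.
move=> AC; have q0 : (0 < #|F|)%N by apply/card_gt0P; exists 0.
apply/eqP; rewrite -(eqn_pmul2r (m := #|F| ^ \dim A)) ?expn_gt0 ?q0 //.
rewrite -expnD subnK ?dimvS // mulSn -mulnA.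
rewrite -(@card_overspaces A _ [pred x | (x \in C) && (x \notin A)]).
- rewrite -!card_vspace_row -[#|C|](cardID (mem A)); apply/eqP; congr (_ + _)%N.
    by apply: eq_card => x; rewrite !inE andb_idl //; apply/subvP.
  by apply: eq_card => x; rewrite !inE andbC.
- by move=> S /andP[].
- move=> x /=; case xA: (x \in A); rewrite ?andbF //= andbT codim1_addv ?xA //=.
  by rewrite subv_add AC /= memvE.
Qed.


(** * Orthogonals for a nondegenerate form *)

Variable B : {symmetric U}.
Local Notation "S ^!" := (orthov B S).

Lemma orthovDI S T : ((S + T)^! = S^! :&: T^!)%VS.
Proof.
by apply/vspaceP => x; rewrite memv_cap !memvE -!memvE ![x \in _]memvE orthovD.
Qed.

Lemma orthov_sub S T : (S <= T)%VS -> (T^! <= S^!)%VS.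
Proof. by move=> /addv_idPr <-; rewrite orthovDI capvSl. Qed.

(** Induction on a basis of [S]: each new vector imposes one linear condition and costs at most one
    dimension. *)
Lemma dim_cap_orthov S T : (\dim T - \dim S <= \dim (T :&: S^!)%VS)%N.
Proof.
suff H X : (\dim T - size X <= \dim (T :&: <<X>>^!)%VS)%N.
  by have := H (vbasis S); rewrite size_tuple (span_basis (vbasisP S)).
elim: X => [|x X IH] /=; first by rewrite span_nil orthov0 capvf subn0.
rewrite span_cons addvC orthovDI capvA subnS.
by apply: leq_trans (leq_dim_orthov1 B x _); rewrite -!subn1 leq_sub2r.
Qed.

Lemma sub_orthov_orthov S : (S <= (S^!)^!)%VS.
Proof. by rewrite orthov_sym. Qed.

Hypothesis hB : nondegenerate B.

Lemma dim_orthov S : \dim S^! = (Ndim d - \dim S)%N.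
Proof.
have dimU : \dim (fullv : {vspace U}) = Ndim d by rewrite dimvf /dim /= mul1n.
apply/eqP; rewrite eqn_leq; apply/andP; split; last first.
  by have := dim_cap_orthov S fullv; rewrite capfv dimU.
(* A vector of [S] orthogonal to a complement of [S^!] is also orthogonal to [S^!], hence to
   everything, so it is 0. This bounds [\dim S] by the dimension of that complement. *)
have := dim_cap_orthov (S^!)^C S.
suff -> : (S :&: ((S^!)^C)^! = 0)%VS.
  by rewrite dimv0 dimv_compl dimU; have := dimvS (subvf S^!); rewrite dimU; dimlia.
apply/eqP; rewrite -subv0 -(eqP hB) -(addv_complf S^!) orthovD capvSr andbT.
exact: subv_trans (capvSl _ _) (sub_orthov_orthov _).
Qed.

Lemma dimv_le S : (\dim S <= Ndim d)%N.
Proof. by have := dimvS (subvf S); rewrite dimvf /dim /= mul1n. Qed.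

Lemma orthovK S : (S^!)^! = S.
Proof.
apply/esym/eqP; rewrite -(geq_leqif (dimv_leqif_eq (sub_orthov_orthov S))).
by rewrite !dim_orthov; have := dimv_le S; dimlia.
Qed.

Lemma orthov_subE S T : (T^! <= S^!)%VS = (S <= T)%VS.
Proof.
by apply/idP/idP => [/orthov_sub | /orthov_sub //]; rewrite !orthovK.
Qed.

Lemma codim1_orthov S T : codim1 S^! T^! = codim1 T S.
Proof.
rewrite /codim1 orthov_subE !dim_orthov; congr (_ && _).
by have := dimv_le S; have := dimv_le T; dimlia.
Qed.

(** Dual of [card_lines]: taking orthogonals is an inclusion-reversing involution, so hyperplanes of
    [C] over [A] become lines of [A^! / C^!]. *)
Lemma card_hyperplanes A C : (A <= C)%VS ->
  (#|[set S | codim1 S C && (A <= S)%VS]| * #|F|.-1).+1%N = (#|F| ^ (\dim C - \dim A))%N.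
Proof.
move=> AC; have := card_lines (orthov_sub AC).
rewrite !dim_orthov (_ : _ - _ = \dim C - \dim A)%N; last first.
  by have := dimv_le C; have := dimv_le A; have := dimvS AC; dimlia.
move=> <-; congr (_ * _).+1%N.
have orthov_inj : injective (orthov B : {vspace U} -> {vspace U}) by apply: can_inj orthovK.
rewrite -(card_imset _ orthov_inj); apply: eq_card => S; apply/imsetP/idP => [[T + ->]|].
  by rewrite !inE codim1_orthov orthov_subE.
by rewrite inE => h; exists S^!; rewrite ?orthovK // inE -[C]orthovK codim1_orthov -[A]orthovK orthov_subE.
Qed.

(** * Isotropic extensions of a subspace *)

Hypothesis hF : odd #|F|.

Lemma form_sym x y : B x y = B y x.
Proof. by rewrite hermC /= expr0 mul1r. Qed.

(** Otherwise 1 would have order 2 in the additive group, whose order is odd. *)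
Lemma two_neq0 : (2%:R : F) != 0.
Proof.
apply/negP => two0.
have ord2 : #[1%R : F]%g = 2%N.
  have : (#[1%R : F]%g %| 2)%N by rewrite order_dvdn.
  rewrite dvdn_divisors // inE => /orP[|]; last by rewrite inE => /eqP.
  by rewrite order_eq1 => /eqP/eqP; rewrite oner_eq0.
have := order_dvdG (in_setT (1%R : F)).
by rewrite ord2 cardsT dvdn2 hF.
Qed.

Lemma isotropic_line x A : (A <= A^!)%VS ->
  (A + <[x]> <= (A + <[x]>)^!)%VS = (x \in A^!) && (B x x == 0).
Proof.
move=> hA; rewrite orthoDv !orthovD hA -[(<[x]> <= <[x]>^!)%VS]memvE mem_orthov1.
by rewrite orthov_sym -memvE andbA andbb.
Qed.

Lemma codim1_witness A A' : codim1 A A' ->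
  exists2 u, u \notin A & A' = (A + <[u]>)%VS.
Proof.
move=> AA'; have : ~~ (A' <= A)%VS.
  by apply/negP => /dimvS; rewrite (codim1_dim AA') ltnn.
case/subvPn => u uA' uA; exists u => //.
by apply/esym/eqP; rewrite -(codim1_addvE AA').
Qed.

(* For u in A' outside A, exactly one vector of each line x + F u is isotropic
   when x is orthogonal to A but not to u. *)
Lemma card_transverse_isotropic A A' : codim1 A A' -> (A' <= A'^!)%VS ->
  #|[set S | [&& codim1 A S, (S <= S^!)%VS & ~~ (S <= A'^!)%VS]]|
  = (#|F| ^ (Ndim d - \dim A' - \dim A'))%N.
Proof.
move=> AA' hA'; have q1 : (1 < #|F|)%N := finNzRing_gt1 F.
have [u uA defA'] := codim1_witness AA'.
have sAA' := codim1_sub AA'; have dA' := codim1_dim AA'.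
have hA : (A <= A^!)%VS := subv_trans sAA' (subv_trans hA' (orthov_sub sAA')).
have AA'o : (A <= A'^!)%VS := subv_trans sAA' hA'.
have Buu : B u u = 0.
  by have /(_ u u) := (orthovP hA'); apply; rewrite defA' memvE addvSr.
have memA'o x : (x \in A'^!) = (x \in A^!) && (B x u == 0).
  by rewrite defA' orthovDI memv_cap mem_orthov1.
have uAo : u \in A^!.
  by have := subv_trans hA' (orthov_sub sAA'); rewrite defA' subv_add -memvE => /andP[].
pose X := [pred x | [&& x \in A^!, B x x == 0 & B x u != 0]].
have cardX := @card_overspaces A
  (fun S => [&& codim1 A S, (S <= S^!)%VS & ~~ (S <= A'^!)%VS]) X.
have {}cardX : #|X| = (#|[set S | [&& codim1 A S, (S <= S^!)%VS & ~~ (S <= A'^!)%VS]]|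
                       * (#|F|.-1 * #|F| ^ \dim A))%N.
  apply: cardX => [S /andP[]// | x].
  rewrite isotropic_line // subv_add AA'o -memvE memA'o /=.
  case xA: (x \in A) => /=.
    have := subvP AA'o _ xA; rewrite memA'o => /andP[_ ->]; rewrite /= !andbF //.
  rewrite codim1_addv ?xA //=; by case: (x \in A^!); rewrite //= andbC.
have cardXF : (#|X| * #|F| = #|F| ^ (Ndim d - \dim A) - #|F| ^ (Ndim d - \dim A'))%N.
  rewrite -!dim_orthov // -!card_vspace_row.
  have <- : #|[predI A^! & A'^!]| = #|A'^!|.
    by apply: eq_card => x; rewrite !inE memA'o andbA andbb.
  rewrite -[X in (X - _)%N](cardID (mem A'^!)) addKn -cardsE -(cardsE F) -cardsX.
  (* As [B u u = 0], the quadratic form is affine along [x + F u], with slope [2 * B x u]. Hence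
     there is exactly one isotropic vector on each such line, and [f] is a bijection from [X * F]
     onto [A^!] minus [A'^!]. *)
  pose f (p : U * F) := p.1 + p.2 *: u.
  have Bf p : B (f p) (f p) = B p.1 p.1 + 2%:R * (p.2 * B p.1 u).
    rewrite /f linearDl !linearDr /= !linearZl_LR !linearZr_LR /= Buu !mulr0 addr0.
    by rewrite (form_sym u) /= -addrA -mulr2n mulr_natl.
  have Bfu p : B (f p) u = B p.1 u by rewrite /f linearDl /= linearZl_LR /= Buu mulr0 addr0.
  rewrite -(card_in_imset (f := f)); last first.
    move=> [x s] [y t]; rewrite !inE /= => /andP[/and3P[_ /eqP x0 xu] _] /andP[/and3P[_ /eqP y0 yu] _] E.
    have Exy : B x u = B y u by rewrite -(Bfu (x, s)) E Bfu.
    have : B (f (x, s)) (f (x, s)) = B (f (y, t)) (f (y, t)) by rewrite E.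
    rewrite !Bf /= x0 y0 !add0r Exy => /(mulfI two_neq0)/(mulIf yu) Est.
    by move: E; rewrite /f /= Est => /addIr ->.
  apply: eq_card => z; rewrite !inE; apply/imsetP/idP => [[[x t]] | ].
    rewrite !inE /= andbT => /and3P[xA _ xu] ->.
    have fA : f (x, t) \in A^! by rewrite memvD ?memvZ.
    by rewrite fA memA'o fA Bfu xu.
  rewrite memA'o => /andP[]; case zA: (z \in A^!) => //= zu _.
  (* The root of the affine function above: [z - t *: u] is isotropic. *)
  pose t := B z z / (2%:R * B z u).
  exists (f (z, - t), t); last by rewrite /f /= scaleNr subrK.
  rewrite !inE /= Bfu zu !andbT Bf /= memvD ?memvZ //=.
  by rewrite mulrCA mulNr divfK ?subrr // mulf_neq0 ?two_neq0.
(* The multiplier combines the [(q - 1) * q ^ \dim A] vectors [x] that yield the same [S] with the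
   [q] values of the parameter [t]. *)
apply/eqP; rewrite -(eqn_pmul2r (m := (#|F|.-1 * #|F| ^ \dim A) * #|F|)); last first.
  by rewrite !muln_gt0 expn_gt0 -subn1 subn_gt0 q1 ltnW.
rewrite mulnA -cardX cardXF dA'.
have dim_le : (\dim A' <= Ndim d - \dim A')%N by rewrite -dim_orthov // dimvS.
by rewrite dA' in dim_le *; rewrite expn_sub_transverse.
Qed.

(* S is sent to S + A', with q preimages for each isotropic extension of A'. *)
Lemma card_extend_isotropic A A' : codim1 A A' -> (A' <= A'^!)%VS ->
  #|[set S | [&& codim1 A S, (S <= S^!)%VS, (S <= A'^!)%VS & S != A']]|
  = (#|F| * #|[set S | codim1 A' S && (S <= S^!)%VS]|)%N.
Proof.
move=> AA' hA'; have sAA' := codim1_sub AA'; have dA' := codim1_dim AA'.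
have q1 : (1 < #|F|)%N := finNzRing_gt1 F.
rewrite -[LHS]sum1_card (partition_big (fun S => S + A')%VS
  (fun Z => codim1 A' Z && (Z <= Z^!)%VS)) /=; last first.
  move=> S; rewrite inE => /and4P[AS hS SA' neSA'].
  have [x xA defS] := codim1_witness AS.
  have xA' : x \notin A'.
    apply: contra neSA' => xA'; apply/eqP; rewrite defS.
    by apply/eqP; rewrite -(codim1_addvE AA').
  have -> : (S + A' = A' + <[x]>)%VS by rewrite defS -addvA addvC -addvA (addv_idPl sAA') addvC.
  rewrite codim1_addv //= isotropic_line //; move: SA' hS; rewrite defS subv_add isotropic_line.
    by rewrite -[(<[x]> <= _)%VS]memvE => /andP[_ ->] /andP[].
  exact: subv_trans sAA' (subv_trans hA' (orthov_sub sAA')).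
rewrite mulnC -sum_nat_const big_set /=; apply: eq_bigr => Z /andP[A'Z hZ].
have sA'Z := codim1_sub A'Z; have sAZ := subv_trans sAA' sA'Z.
(* The plane [Z / A] has [q + 1] lines; removing [A' / A] leaves the [q] preimages of [Z]. *)
have cardS : #|[set S | codim1 A S && (S <= Z)%VS]| = #|F|.+1.
  have := card_lines sAZ; rewrite (codim1_dim A'Z) dA' -addn2 addKn.
  by move: #|_| #|F| q1 => N q q1; clear -q1; case: q q1 => // q; nia.
apply/eqP; rewrite -(eqn_add2l 1) [X in _ == X]add1n -cardS (cardsD1 A') inE AA' sA'Z /=.
rewrite sum1_card; apply/eqP; congr (_ + _)%N; apply: eq_card => S; rewrite unfold_in /= !inE.
have [->|neS] := eqVneq S A'; first by rewrite /= !andbF.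
rewrite /= !andbT.
case AS: (codim1 A S); rewrite //=.
apply/idP/idP => [/andP[_ /eqP <-]|SZ]; first exact: addvSl.
rewrite (subv_trans SZ (subv_trans hZ (orthov_sub SZ))).
rewrite (subv_trans SZ (subv_trans hZ (orthov_sub sA'Z))) /=.
have SA'Z : (S + A' <= Z)%VS by rewrite subv_add SZ.
rewrite -(geq_leqif (dimv_leqif_eq SA'Z)) (codim1_dim A'Z) ltnNge.
apply: contra neS; rewrite (geq_leqif (dimv_leqif_eq (addvSr S A'))) => /eqP defA'.
have SA' : (S <= A')%VS by rewrite defA' addvSl.
by rewrite -(geq_leqif (dimv_leqif_eq SA')) dA' (codim1_dim AS).
Qed.

(** The spaces [S] are [A'] itself, the other ones orthogonal to [A'], and those not orthogonal to
    [A']. For [m = Ndim d - 2 * \dim A'] the quotients [A^! / A] and [A'^! / A'] have dimensions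
    [m + 2] and [m], so this is [I(m + 2) = 1 + q I(m) + q^m]. *)
Lemma card_isotropic A A' : codim1 A A' -> (A' <= A'^!)%VS ->
  #|[set S | codim1 A S && (S <= S^!)%VS]|
  = (1 + #|F| * #|[set S | codim1 A' S && (S <= S^!)%VS]|
     + #|F| ^ (Ndim d - \dim A' - \dim A'))%N.
Proof.
move=> AA' hA'.
rewrite -(card_extend_isotropic AA' hA') -(card_transverse_isotropic AA' hA').
rewrite -[LHS](cardsID [set S | (S <= A'^!)%VS]); congr (_ + _)%N; last first.
  by apply: eq_card => S; rewrite !inE andbC andbA.
rewrite [LHS](cardsD1 A') !inE AA' hA' /=; congr (_ + _)%N.
by apply: eq_card => S; rewrite !inE; do !case: (_ <= _)%VS; rewrite ?andbF ?andbT //= andbC.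
Qed.

End Counting.

(** * Isotropic flags *)

Section FlagParts.
Variables (n d : nat) (F : finFieldType).
Local Notation U := 'rV[F]_(Ndim d).
Variable B : {symmetric U}.
Local Notation "S ^!" := (orthov B S).
Local Notation flag := (flag n B).
Implicit Types (V W : flag) (S T : {vspace U}).

Lemma Vpart0 V : Vpart V 0 = 0%VS.
Proof.
case: V => V /= hV; have /and4P[/eqP <- _ _ _] := hV.
by rewrite /Vpart /=; congr (V _); apply: val_inj; rewrite /= inordK.
Qed.

Lemma Vpart_full V : Vpart V (Ndim n) = fullv.
Proof.
case: V => V /= hV; have /and4P[_ /eqP <- _ _] := hV.
by rewrite /Vpart /=; congr (V _); apply: val_inj; rewrite /= inordK.
Qed.

Lemma Vpart_sub V k l : (k <= l)%N -> (l <= Ndim n)%N -> (Vpart V k <= Vpart V l)%VS.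
Proof.
case: V => V /= hV kl lN; have /and4P[_ _ /forallP/(_ (inord k)) + _] := hV.
by move=> /forallP/(_ (inord l))/implyP; apply; rewrite !inordK // ltnS (leq_trans kl).
Qed.

Lemma Vpart_orthov V k : (k <= Ndim n)%N -> Vpart V k = (Vpart V (Ndim n - k))^!.
Proof.
case: V => V /= hV kN; have /and4P[_ _ _ /forallP/(_ (inord k))/eqP] := hV.
rewrite /Vpart /= => ->; congr (V _)^!; apply: val_inj.
by rewrite /= !inordK // ltnS ?leq_subr // subSS.
Qed.

Lemma Vpart_isotropic V k : (k <= n)%N -> (Vpart V k <= (Vpart V k)^!)%VS.
Proof.
move=> kn; rewrite {1}Vpart_orthov; last by rewrite /Ndim; move: kn; dimlia.
by rewrite orthov_sub // Vpart_sub // /Ndim; move: kn; dimlia.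
Qed.

Lemma flag_ext V W :
  (forall k, (0 < k <= n)%N -> Vpart V k = Vpart W k) -> V = W.
Proof.
move=> eqVW.
have eq_le k : (k <= n)%N -> Vpart V k = Vpart W k.
  by case: k => [_|k kn]; [rewrite !Vpart0 | apply: eqVW].
have eq_all k : (k <= Ndim n)%N -> Vpart V k = Vpart W k.
  move=> kN; case: (leqP k n) => [/eq_le // | nk].
  rewrite Vpart_orthov // [RHS]Vpart_orthov // eq_le //.
  by move: nk kN; rewrite /Ndim; dimlia.
apply: val_inj; apply/ffunP => k; have := eq_all k.
by rewrite /Vpart inord_val; apply; rewrite -ltnS.
Qed.

Hypothesis hB : nondegenerate B.

(** The upper half consists of the orthogonals of the lower one; the inclusion that links the two
    halves is the isotropy of [T n]. *)
Lemma flag_exists (T : nat -> {vspace U}) :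
    T 0%N = 0%VS -> (forall k, (k < n)%N -> (T k <= T k.+1)%VS) -> (T n <= (T n)^!)%VS ->
  {V : flag | forall k, (k <= n)%N -> Vpart V k = T k}.
Proof.
move=> T0 Tsub Tn.
have Tmono k l : (k <= l)%N -> (l <= n)%N -> (T k <= T l)%VS.
  elim: l => [|l IH]; first by rewrite leqn0 => /eqP ->.
  rewrite leq_eqVlt => /predU1P[-> // | kl ln].
  exact: subv_trans (IH kl (ltnW ln)) (Tsub _ ln).
pose f := [ffun k : 'I_(Ndim n).+1 => if (k <= n)%N then T k else (T (Ndim n - k)%N)^!].
have hf : is_flag B f.
  apply/and4P; split.
  - by rewrite ffunE /= T0.
  - rewrite ffunE /= subnn T0 orthov0 ifF //.
    by apply/negbTE; rewrite -ltnNge /Ndim; dimlia.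
  - apply/forallP => k; apply/forallP => l; apply/implyP => kl; rewrite !ffunE.
    have lN := ltn_ord l; have kN := ltn_ord k.
    case: (leqP k n) => kn; case: (leqP l n) => ln; first exact: Tmono.
    + have kT := Tmono _ _ kn (leqnn n); apply: subv_trans kT _.
      apply: subv_trans Tn _; apply: orthov_sub.
      by apply: Tmono => //; move: ln lN; rewrite /Ndim; dimlia.
    + by move: kl kn ln; dimlia.
    + by apply: orthov_sub; apply: Tmono; move: kl kn lN; rewrite /Ndim; dimlia.
  - apply/forallP => k; rewrite !ffunE /= subSS.
    have kN : (k <= Ndim n)%N by rewrite -ltnS.
    case: (leqP k n) => kn.
      rewrite ifF ?subKn ?orthovK //.
      by apply/negbTE; rewrite -ltnNge; move: kn; rewrite /Ndim; dimlia.
    by rewrite ifT //; move: kn kN; rewrite /Ndim; dimlia.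
exists (MkFlag hf) => k kn.
by rewrite /Vpart /= ffunE inordK ?kn // ltnS /Ndim; move: kn; dimlia.
Qed.

Definition agree_off2 (i j : nat) V W : bool :=
  [forall k : 'I_n.+1, [&& (0 < k)%N, k != i :> nat & k != j :> nat]
     ==> (Vpart V k == Vpart W k)].

Lemma agree_offP i V W :
  reflect (forall k, (k <= n)%N -> k <> i -> Vpart V k = Vpart W k) (agree_off i V W).
Proof.
apply: (iffP forallP) => [H [_ _|k kn ki]|H k]; first by rewrite !Vpart0.
  by apply/eqP; have /implyP := H (Ordinal (kn : (k.+1 < n.+1)%N)); apply=> /=; apply/eqP.
by apply/implyP => /andP[_ /eqP ki]; rewrite H // -ltnS.
Qed.

Lemma agree_off2P i j V W :
  reflect (forall k, (k <= n)%N -> k <> i -> k <> j -> Vpart V k = Vpart W k)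
          (agree_off2 i j V W).
Proof.
apply: (iffP forallP) => [H [_ _ _|k kn ki kj]|H k]; first by rewrite !Vpart0.
  by apply/eqP; have /implyP := H (Ordinal (kn : (k.+1 < n.+1)%N)); apply=> /=; apply/andP; split; apply/eqP.
by apply/implyP => /and3P[_ /eqP ki /eqP kj]; rewrite H // -ltnS.
Qed.

Lemma agree_offC i V W : agree_off i V W = agree_off i W V.
Proof. by apply/agree_offP/agree_offP => H k kn ki; rewrite H. Qed.

Lemma agree_off_trans i V W V' : agree_off i V W -> agree_off i W V' = agree_off i V V'.
Proof.
move=> /agree_offP VW.
by apply/agree_offP/agree_offP => H k kn ki; rewrite ?VW ?H // -VW ?H.
Qed.

Lemma agree_off_ext i V W : agree_off i V W -> Vpart V i = Vpart W i -> V = W.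
Proof.
move=> /agree_offP VW E; apply: flag_ext => k /andP[_ kn].
by have [->|/eqP ki] := eqVneq k i => //; apply: VW.
Qed.

(* The spaces that can be put at the i-th place of V. *)
Definition replaceable (i : nat) V S : bool :=
  (Vpart V i.-1 <= S)%VS && (if (i < n)%N then S <= Vpart V i.+1 else S <= S^!)%VS.

Lemma replaceable_agree i V W : (0 < i <= n)%N -> agree_off i V W ->
  replaceable i V =1 replaceable i W.
Proof.
move=> /andP[i0 hi] /agree_offP VW S; rewrite /replaceable.
rewrite VW; [|by move: i0 hi; dimlia..].
by case: ltnP => // ltn; rewrite VW //; move: i0; dimlia.
Qed.

Lemma replaceable_part i V : (0 < i <= n)%N -> replaceable i V (Vpart V i).
Proof.
move=> /andP[i0 hi]; rewrite /replaceable Vpart_sub ?leq_pred //=; last first.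
  by rewrite /Ndim; move: hi; dimlia.
case: ltnP => ltn; last exact: Vpart_isotropic.
by rewrite Vpart_sub // /Ndim; move: ltn; dimlia.
Qed.

(** At [i = n] the upper neighbour [V_(n+1)] is the orthogonal of the replaced space and moves with
    it, so the upper bound on [S] turns into isotropy of [S]. *)
Lemma replace_part i V S : (0 < i <= n)%N -> replaceable i V S ->
  {W | agree_off i V W & Vpart W i = S}.
Proof.
move=> /andP[i0 hi] /andP[subS Ssub].
have [||| W hW] := @flag_exists (fun k => if k == i then S else Vpart V k).
- by rewrite ifF ?Vpart0 // eq_sym; apply/negbTE; rewrite -lt0n.
- move=> k kn; have [ki|ki] := eqVneq k i.
    by rewrite ki gtn_eqF // -ki; move: Ssub; rewrite -ki kn.
  have [ki'|ki'] := eqVneq k.+1 i; first by move: subS; rewrite -ki'.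
  by rewrite Vpart_sub // /Ndim; move: kn; dimlia.
- case: eqP => [ni|_]; last exact: Vpart_isotropic.
  by move: Ssub; rewrite -ni ltnn.
exists W; last by rewrite hW ?eqxx.
by apply/agree_offP => k kn /eqP ki; rewrite hW // (negbTE ki).
Qed.

(** A flag agreeing with [V] off [i] is determined by its [i]-th part, so that counts of flags
    become counts of subspaces. *)
Lemma card_agree_off i V (P : pred {vspace U}) : (0 < i <= n)%N ->
  #|[set W | agree_off i V W && P (Vpart W i)]| = #|[set S | replaceable i V S && P S]|.
Proof.
move=> hi; rewrite -(card_in_imset (f := fun W => Vpart W i)); last first.
  move=> W W'; rewrite !inE => /andP[VW _] /andP[VW' _]; apply: agree_off_ext.
  by rewrite (agree_off_trans _ VW).
apply: eq_card => S; rewrite inE; apply/imsetP/idP => [[W + ->]|/andP[hS PS]].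
  by rewrite inE => /andP[VW ->]; rewrite (replaceable_agree hi VW) replaceable_part.
by have [W VW WS] := replace_part hi hS; exists W; rewrite // inE VW WS.
Qed.

End FlagParts.

(** * Paths of flags *)

Section Relations.
Variables (n d : nat) (F : finFieldType).
Local Notation U := 'rV[F]_(Ndim d).
Variable B : {symmetric U}.
Local Notation "S ^!" := (orthov B S).
Local Notation flag := (flag n B).
Local Notation q := #|F|.
Implicit Types (V W : flag) (S T A C : {vspace U}) (r s : flag -> flag -> bool).
Implicit Types (P Q : {vspace U} -> {vspace U} -> bool).

Definition codim2 S T : bool := (S <= T)%VS && (\dim T == (\dim S).+2).

Definition paths r s V V' : nat := #|[set W | r V W && s W V']|.

Definition step i P V W : bool := agree_off i V W && P (Vpart V i) (Vpart W i).

Definition up i := step i (@codim1 d F).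
Definition down i := step i (fun S T => codim1 T S).
Definition up2 i := step i codim2.

(* The path goes through the flag with i-th part [Vpart W i] and j-th part
   [Vpart V j]; the last two clauses say that this is a flag. *)
Definition step2 i j P Q V W : bool :=
  [&& agree_off2 i j V W, P (Vpart V i) (Vpart W i), Q (Vpart V j) (Vpart W j),
      (j == i.+1) ==> (Vpart W i <= Vpart V j)%VS
    & (i == j.+1) ==> (Vpart V j <= Vpart W i)%VS].

Lemma codim1_trans A S C : codim1 A S -> codim1 S C -> codim2 A C.
Proof.
by move=> /andP[AS /eqP dS] /andP[SC /eqP dC]; rewrite /codim2 (subv_trans AS SC) dC dS eqxx.
Qed.

Lemma codim2_between A C S : codim2 A C ->
  codim1 A S && codim1 S C = codim1 A S && (S <= C)%VS.
Proof.
move=> /andP[_ /eqP dC]; rewrite /codim1 dC.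
by case: (A <= S)%VS => //=; case: eqP => //= ->; rewrite eqxx andbT.
Qed.

Lemma card_between A C : 
  #|[set S | codim1 A S && codim1 S C]| = (codim2 A C * q.+1)%N.
Proof.
case: (boolP (codim2 A C)) => [AC|nAC]; last first.
  rewrite mul0n; apply/eqP; rewrite cards_eq0 -subset0; apply/subsetP => S.
  by rewrite !inE => /andP[/codim1_trans h /h]; rewrite (negbTE nAC).
have /andP[sAC /eqP dC] := AC.
have -> : [set S | codim1 A S && codim1 S C] = [set S | codim1 A S && (S <= C)%VS].
  by apply/setP => S; rewrite !inE codim2_between.
have := card_lines sAC; rewrite dC -addn2 addKn mul1n.
have := finNzRing_gt1 F.
by move: #|_| #|F| => N k; clear; case: k => // k; nia.
Qed.

Lemma replaceable_between i V A C S : replaceable i V A -> replaceable i V C ->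
  (A <= S)%VS -> (S <= C)%VS -> replaceable i V S.
Proof.
move=> /andP[VA _] /andP[_ CV] AS SC; rewrite /replaceable (subv_trans VA AS) /=.
case: ltnP CV => _ CV; first exact: subv_trans SC CV.
exact: subv_trans SC (subv_trans CV (orthov_sub _ SC)).
Qed.

Hypothesis hB : nondegenerate B.

Lemma paths_same i P Q V V' : (0 < i <= n)%N ->
  paths (step i P) (step i Q) V V' =
  (agree_off i V V' *
    #|[set S | [&& replaceable i V S, P (Vpart V i) S & Q S (Vpart V' i)]]|)%N.
Proof.
move=> hi; rewrite /paths.
rewrite -(card_agree_off hB V (fun S => P (Vpart V i) S && Q S (Vpart V' i))) //.
case: (boolP (agree_off i V V')) => VV'; rewrite ?mul1n ?mul0n.
  apply: eq_card => W; rewrite !inE /step.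
  case: (boolP (agree_off i V W)) => //= VW.
  by rewrite (agree_off_trans _ VW) VV'.
apply/eqP; rewrite cards_eq0 -subset0; apply/subsetP => W; rewrite !inE.
by move=> /andP[/andP[VW _] /andP[WV' _]]; rewrite -(agree_off_trans _ VW) WV' in VV'.
Qed.

(** The middle flag must take its [i]-th part from [V'] and all others from [V]. Only for adjacent
    places can this choice fail to be a flag. *)
Lemma paths_other i j P Q V V' : (0 < i <= n)%N -> (0 < j <= n)%N -> i <> j ->
  paths (step i P) (step j Q) V V' = step2 i j P Q V V' :> nat.
Proof.
move=> hi hj ij; have [i0 ni] := andP hi; have [j0 nj] := andP hj; rewrite /paths.
have parts W : agree_off i V W -> agree_off j W V' ->
  [/\ Vpart W i = Vpart V' i, Vpart W j = Vpart V j & agree_off2 i j V V'].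
  move=> /agree_offP VW /agree_offP WV'; split; first exact: WV'.
    by rewrite VW //; apply/nesym.
  by apply/agree_off2P => k kn ki kj; rewrite VW // WV'.
case: (boolP (step2 i j P Q V V')) => /=; last first.
  move=> H; apply/eqP; rewrite cards_eq0 -subset0; apply/subsetP => W; rewrite !inE.
  move=> /andP[/andP[VW PW] /andP[WV' QW]]; case/negP: H; rewrite /step2.
  have [Wi Wj ->] := parts W VW WV'; rewrite -Wi -Wj PW QW /=.
  by apply/andP; split; apply/implyP => /eqP E; rewrite Vpart_sub // /Ndim;
    move: ni nj E; dimlia.
move=> /and5P[/agree_off2P VV' PV QV okij okji].
have /(replace_part hB hi)[W VW Wi] : replaceable i V (Vpart V' i).
  have /andP[sub1 sub2] := replaceable_part V' hi; rewrite /replaceable.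
  apply/andP; split.
    have [eij|nij] := eqVneq i j.+1; first by move: okji; rewrite eij eqxx.
    by rewrite VV' //; move: i0 ni nij; dimlia.
  case: ltnP sub2 => // lt_in.
  have [eij|nij] := eqVneq j i.+1; first by move: okij; rewrite eij eqxx.
  by rewrite VV' //; move: nij; dimlia.
have VWa := agree_offP _ _ _ VW.
apply/eqP/cards1P; exists W; apply/setP => W'; rewrite !inE; apply/idP/eqP => [|->].
  move=> /andP[/andP[VW' _] /andP[W'V' _]]; have [W'i _ _] := parts W' VW' W'V'.
  rewrite agree_offC in VW'; apply: (agree_off_ext (i := i)); last by rewrite W'i Wi.
  by rewrite -(agree_off_trans _ VW').
have Wj : Vpart W j = Vpart V j by rewrite VWa //; apply/nesym.
rewrite /step VW Wi PV Wj QV /= andbT; apply/agree_offP => k kn kj.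
by have [->|/eqP ki] := eqVneq k i => //; rewrite -VWa // VV'.
Qed.

(** Before the last move, at [i], the [j]-th part is already that of [V']. Only the [i]-th part [S]
    is free, and the incidences in [step2] become conditions on [S]. This serves the products
    [E i *m E j *m E i]. *)
Lemma paths_back i j P Q P' V V' : (0 < i <= n)%N -> (0 < j <= n)%N -> i <> j ->
  paths (step2 i j P Q) (step i P') V V' =
  (agree_off2 i j V V' && Q (Vpart V j) (Vpart V' j) *
    #|[set S | replaceable i V' S && [&& P (Vpart V i) S, P' S (Vpart V' i),
        (j == i.+1) ==> (S <= Vpart V j)%VS & (i == j.+1) ==> (Vpart V j <= S)%VS]]|)%N.
Proof.
move=> hi hj ij; have [j0 nj] := andP hj.
rewrite -(card_agree_off hB V' (fun S => [&& P (Vpart V i) S, P' S (Vpart V' i),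
  (j == i.+1) ==> (S <= Vpart V j)%VS & (i == j.+1) ==> (Vpart V j <= S)%VS])) //.
have agree W : agree_off i W V' ->
  (agree_off2 i j V W = agree_off2 i j V V') * (Vpart W j = Vpart V' j).
  move=> /agree_offP WV'; split; last by rewrite WV' //; apply/nesym.
  by apply/agree_off2P/agree_off2P => H k kn ki kj; rewrite ?WV' ?H // -WV' ?H.
rewrite /paths; case: (boolP (_ && _)) => [/andP[VV' QV]|H]; rewrite ?mul1n ?mul0n.
  apply: eq_card => W; rewrite !inE /step2 /step [agree_off i V' W]agree_offC.
  case: (boolP (agree_off i W V')) => WV'; rewrite ?andbF //= !(agree _ WV') VV' QV /=.
  by rewrite -!andbA; do ?bool_congr; rewrite [RHS]andbC -!andbA; do ?bool_congr.
apply/eqP; rewrite cards_eq0 -subset0; apply/subsetP => W; rewrite !inE.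
move=> /andP[/and5P[VW _ QW _ _] /andP[WV' _]]; case/negP: H.
by rewrite -!(agree _ WV') VW QW.
Qed.

Lemma geometric1 N k : (1 < k)%N -> (N * k.-1).+1%N = (k ^ 1)%N -> N = 1%N.
Proof. by clear; case: k => // k; nia. Qed.

Lemma geometric2 N k : (1 < k)%N -> (N * k.-1).+1%N = (k ^ 2)%N -> N = k.+1.
Proof. by clear; case: k => // k; nia. Qed.

(** These are the lines of [(C :&: T) / A]. Since [T] is a hyperplane of [T'] and [T'] contains [C],
    the intersection is [C] or a hyperplane of [C], giving [q + 1] lines or a single one. *)
Lemma card_between_below A C T T' : codim2 A C -> codim1 T T' ->
    (A <= T)%VS -> (C <= T')%VS ->
  #|[set S | [&& codim1 A S, codim1 S C & (S <= T)%VS]]| = (q * (C <= T)%VS).+1%N.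
Proof.
move=> AC /andP[TT' /eqP dT'] AT CT'; have /andP[sAC /eqP dC] := AC.
have -> : [set S | [&& codim1 A S, codim1 S C & (S <= T)%VS]]
          = [set S | codim1 A S && (S <= C :&: T)%VS].
  by apply/setP => S; rewrite !inE andbA codim2_between // subv_cap andbA.
have q1 := finNzRing_gt1 F.
have := @card_lines _ _ A (C :&: T)%VS; rewrite subv_cap sAC AT => /(_ isT).
case: (boolP (C <= T)%VS) => [CT|nCT].
  by rewrite (capv_idPl CT) dC -addn2 addKn muln1 => /(geometric2 q1).
have -> : (\dim (C :&: T) - \dim A = 1)%N.
  have := dimv_add_leqif C T; have := dimv_cap_compl C T.
  have sCT : (C + T <= T')%VS by rewrite subv_add CT' TT'.
  have := dimvS sCT; have := dimv_sum_cap C T.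
  have : \dim T != \dim (C + T)%VS.
    by apply: contra nCT; rewrite (dimv_leqif_eq (addvSr C T)) => /eqP ->; apply: addvSl.
  have := dimvS (addvSr C T); rewrite dT' dC.
  by clear; dimlia.
by rewrite muln0 => /(geometric1 q1).
Qed.

(** Dual count, of the hyperplanes of [C] over [A + T']: as [A] contains the hyperplane [T] of [T'],
    the sum exceeds [A] by at most one dimension. *)
Lemma card_between_above A C T T' : codim2 A C -> codim1 T T' ->
    (T <= A)%VS -> (T' <= C)%VS ->
  #|[set S | [&& codim1 A S, codim1 S C & (T' <= S)%VS]]| = (q * (T' <= A)%VS).+1%N.
Proof.
move=> AC /andP[TT' /eqP dT'] TA T'C; have /andP[sAC /eqP dC] := AC.
have -> : [set S | [&& codim1 A S, codim1 S C & (T' <= S)%VS]]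
          = [set S | codim1 S C && (A + T' <= S)%VS].
  apply/setP => S; rewrite !inE subv_add /codim1 dC.
  case: (A <= S)%VS; case: (T' <= S)%VS; rewrite ?andbF //= !andbT.
  case: (boolP (S <= C)%VS) => SC; rewrite ?andbF //=.
  by rewrite eqSS [(\dim A).+1 == _]eq_sym andbb.
have q1 := finNzRing_gt1 F.
have := @card_hyperplanes _ _ B hB (A + T')%VS C; rewrite subv_add sAC T'C => /(_ isT).
case: (boolP (T' <= A)%VS) => [T'A|nT'A].
  by rewrite (addv_idPl T'A) dC -addn2 addKn muln1 => /(geometric2 q1).
have -> : (\dim C - \dim (A + T') = 1)%N.
  have := dimv_sum_cap A T'.
  have sT : (T <= A :&: T')%VS by rewrite subv_cap TA TT'.
  have := dimvS sT.
  have : \dim (A :&: T') != \dim T'.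
    by apply: contra nT'A; rewrite (dimv_leqif_eq (capvSr A T')) => /eqP <-; apply: capvSl.
  have := dimvS (capvSr A T'); rewrite dT' dC.
  by clear; dimlia.
by rewrite muln0 => /(geometric1 q1).
Qed.

Lemma paths_up2 i V V' : (0 < i <= n)%N ->
  paths (up i) (up i) V V' = (q.+1 * up2 i V V')%N.
Proof.
move=> hi; rewrite paths_same // /up2 /step.
case: (boolP (agree_off i V V')) => VV'; rewrite ?mul0n ?muln0 //= mul1n mulnC -card_between.
apply: eq_card => S; rewrite !inE andb_idl // => /andP[/codim1_sub AS /codim1_sub SC].
apply: replaceable_between AS SC; first exact: replaceable_part.
by rewrite (replaceable_agree hi VV') replaceable_part.
Qed.

Lemma agree_off2C i j V W : agree_off2 i j V W = agree_off2 j i V W.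
Proof. by apply/agree_off2P/agree_off2P => H k kn ki kj; apply: H. Qed.

(** The count [q * (C <= T) + 1] of [card_between_below] matches term by term. The condition
    [C <= T] is the incidence demanded when both moves at [i] come first; when the move at [i.+1]
    comes first, the incidence is automatic and accounts for the 1. *)
Lemma serre_up_next i V V' : (0 < i)%N -> (i < n)%N ->
  (q * step2 i i.+1 codim2 (@codim1 d F) V V' + step2 i.+1 i (@codim1 d F) codim2 V V'
   = paths (step2 i i.+1 (@codim1 d F) (@codim1 d F)) (up i) V V')%N.
Proof.
move=> i0 ltin; have ii : i <> i.+1 by move=> /n_Sn.
have hi : (0 < i <= n)%N by rewrite i0 ltnW.
rewrite paths_back //= /step2 !eqxx !implyTb.
rewrite [agree_off2 i.+1 i V V']agree_off2C !(ltn_eqF (ltnW (ltnSn i.+1))) /= !andbT.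
case: (boolP (agree_off2 _ _ _ _)) => /= VV'; last by rewrite muln0.
case: (boolP (codim1 (Vpart V i.+1) (Vpart V' i.+1))) => TT'; rewrite ?andbF ?muln0 //=.
case: (boolP (codim2 (Vpart V i) (Vpart V' i))) => AC; rewrite ?andbF //= !mul1n; last first.
  apply/esym/eqP; rewrite muln0 cards_eq0 -subset0; apply/subsetP => S; rewrite !inE.
  by case/and4P => _ AS SC _; rewrite (codim1_trans AS SC) in AC.
have leN : (i.+1 <= Ndim n)%N by rewrite /Ndim; move: ltin; dimlia.
have AT : (Vpart V i <= Vpart V i.+1)%VS by apply: Vpart_sub.
have CT' : (Vpart V' i <= Vpart V' i.+1)%VS by apply: Vpart_sub.
rewrite (subv_trans AT (codim1_sub TT')) addn1 -(card_between_below AC TT') //.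
apply: eq_card => S; rewrite !inE; apply/idP/idP => [/and3P[AS SC ->] | /and5P[_ -> -> ->] //].
rewrite AS SC !andbT; apply: replaceable_between (codim1_sub AS) (codim1_sub SC).
  rewrite /replaceable ltin (subv_trans AT (codim1_sub TT')) andbT.
  by rewrite -(agree_off2P _ _ _ _ VV') ?Vpart_sub ?leq_pred //; move: i0 ltin leN; dimlia.
exact: replaceable_part.
Qed.

(** The same matching with [card_between_above]; here the coefficient [q] goes to the path that
    starts with the move at [j], whose incidence is [T' <= A]. *)
Lemma serre_up_prev j V V' : (0 < j)%N -> (j < n)%N ->
  (step2 j.+1 j codim2 (@codim1 d F) V V' + q * step2 j j.+1 (@codim1 d F) codim2 V V'
   = paths (step2 j.+1 j (@codim1 d F) (@codim1 d F)) (up j.+1) V V')%N.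
Proof.
move=> j0 ltjn; have jj : j.+1 <> j by move=> /esym/n_Sn.
have hj : (0 < j <= n)%N by rewrite j0 ltnW.
rewrite paths_back //= /step2 !eqxx !implyTb.
rewrite [agree_off2 j j.+1 V V']agree_off2C !(ltn_eqF (ltnW (ltnSn j.+1))) /= !andbT.
case: (boolP (agree_off2 _ _ _ _)) => /= VV'; last by rewrite muln0.
case: (boolP (codim1 (Vpart V j) (Vpart V' j))) => TT'; rewrite ?andbF ?muln0 //=.
case: (boolP (codim2 (Vpart V j.+1) (Vpart V' j.+1))) => AC; rewrite ?andbF //= !mul1n; last first.
  apply/esym/eqP; rewrite muln0 cards_eq0 -subset0; apply/subsetP => S; rewrite !inE.
  by case/and4P => _ AS SC _; rewrite (codim1_trans AS SC) in AC.
have leN : (j.+1 <= Ndim n)%N by rewrite /Ndim; move: ltjn; dimlia.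
have TA : (Vpart V j <= Vpart V j.+1)%VS by apply: Vpart_sub.
have T'C : (Vpart V' j <= Vpart V' j.+1)%VS by apply: Vpart_sub.
rewrite (subv_trans TA (proj1 (andP AC))) add1n -(card_between_above AC TT') //.
apply: eq_card => S; rewrite !inE; apply/idP/idP => [/and3P[AS SC T'S] | /and4P[/andP[-> _] -> -> _] //].
rewrite AS SC (subv_trans TA (codim1_sub AS)) !andbT /replaceable /= T'S /=.
have /andP[_] := replaceable_part V' (ltjn : (0 < j.+1 <= n)%N).
case: ltnP => _ h; first exact: subv_trans (codim1_sub SC) h.
by apply: subv_trans (codim1_sub SC) (subv_trans h (orthov_sub _ (codim1_sub SC))).
Qed.

(** For distinct [i]-th parts [A] and [C], the only possible middle parts are [A + C] and [A :&: C],
    and the dimension formula makes them admissible together. For [i < n] the sum stays below the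
    next part; at [i = n] it may fail to be isotropic. *)
Lemma up_down_offdiag i V V' : (0 < i < n)%N -> V != V' ->
  paths (up i) (down i) V V' = paths (down i) (up i) V V'.
Proof.
move=> /andP[i0 ltin] neqV; have hi : (0 < i <= n)%N by rewrite i0 ltnW.
rewrite !paths_same //; case: (boolP (agree_off i V V')) => VV'; rewrite ?mul0n // !mul1n.
set A := Vpart V i; set C := Vpart V' i.
have neqAC : A <> C by move=> eqAC; case/eqP: neqV; apply: agree_off_ext VV' eqAC.
have rA : replaceable i V A := replaceable_part V hi.
have rC : replaceable i V C by rewrite (replaceable_agree hi VV') replaceable_part.
have [subA Asub] := andP rA; have [subC Csub] := andP rC.
rewrite ltin in Asub Csub.
have sum_dim := dimv_sum_cap A C.
have -> : [set S | [&& replaceable i V S, codim1 A S & codim1 C S]] =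
    if codim1 A (A + C)%VS && codim1 C (A + C)%VS then [set (A + C)%VS] else set0.
  have AC_max S : codim1 A S -> codim1 C S -> S = (A + C)%VS.
    move=> AS CS; have ACS : (A + C <= S)%VS by rewrite subv_add !codim1_sub.
    apply/esym/eqP; rewrite -(geq_leqif (dimv_leqif_eq ACS)) (codim1_dim AS) ltnNge.
    apply/negP; rewrite (geq_leqif (dimv_leqif_eq (addvSl A C))) => /eqP defA.
    have CA : (C <= A)%VS by rewrite defA addvSr.
    by apply: neqAC; apply/esym/eqP; rewrite -(geq_leqif (dimv_leqif_eq CA)) -ltnS -(codim1_dim AS) (codim1_dim CS).
  apply/setP => S; rewrite inE; case: ifPn => h; rewrite inE.
    apply/and3P/eqP => [[_ /AC_max h1 /h1]// | ->]; have [AS CS] := andP h; split => //.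
    by rewrite /replaceable ltin (subv_trans subA (addvSl _ _)) subv_add Asub.
  by apply/negP => /and3P[_ AS CS]; rewrite -(AC_max S) // AS CS in h.
have -> : [set S | [&& replaceable i V S, codim1 S A & codim1 S C]] =
    if codim1 A (A + C)%VS && codim1 C (A + C)%VS then [set (A :&: C)%VS] else set0.
  have AC_min S : codim1 S A -> codim1 S C -> S = (A :&: C)%VS.
    move=> SA SC; have SAC : (S <= A :&: C)%VS by rewrite subv_cap !codim1_sub.
    apply/eqP; rewrite -(geq_leqif (dimv_leqif_eq SAC)) -ltnS -(codim1_dim SA) ltnNge.
    apply/negP; rewrite (geq_leqif (dimv_leqif_eq (capvSl A C))) => /eqP defA.
    have AC : (A <= C)%VS by rewrite -defA capvSr.
    by apply: neqAC; apply/eqP; rewrite -(geq_leqif (dimv_leqif_eq AC)) (codim1_dim SA) (codim1_dim SC).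
  have -> : codim1 A (A + C)%VS && codim1 C (A + C)%VS
            = codim1 (A :&: C)%VS A && codim1 (A :&: C)%VS C.
    rewrite /codim1 addvSl addvSr capvSl capvSr /=.
    by move: sum_dim; dimlia.
  apply/setP => S; rewrite inE; case: ifPn => h; rewrite inE.
    apply/and3P/eqP => [[_ /AC_min h1 /h1]// | ->]; have [AS CS] := andP h; split => //.
    by rewrite /replaceable ltin subv_cap subA subC (subv_trans (capvSl _ _) Asub).
  by apply/negP => /and3P[_ AS CS]; rewrite -(AC_min S) // AS CS in h.
by case: ifP => _; rewrite ?cards0 ?cards1.
Qed.

(** Such closed paths correspond to the lines of [V_(i+1) / V_i]; in [down_up_diag] they correspond
    to the hyperplanes of [V_i / V_(i-1)]. *)
Lemma up_down_diag i V : (0 < i < n)%N ->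
  (paths (up i) (down i) V V * q.-1).+1%N = (q ^ gap V i.+1)%N.
Proof.
move=> /andP[i0 ltin]; have hi : (0 < i <= n)%N by rewrite i0 ltnW.
have sub : (Vpart V i <= Vpart V i.+1)%VS by rewrite Vpart_sub // /Ndim; move: ltin; dimlia.
rewrite paths_same // (introT (agree_offP _ _ _)) // mul1n /gap -(card_lines sub).
congr (_ * _).+1%N; apply: eq_card => S; rewrite !inE andbb /replaceable ltin.
case: (boolP (codim1 (Vpart V i) S)) => AS; rewrite ?andbF //= andbT.
rewrite (subv_trans _ (codim1_sub AS)) // Vpart_sub // /Ndim; move: ltin; dimlia.
Qed.

Lemma down_up_diag i V : (0 < i <= n)%N ->
  (paths (down i) (up i) V V * q.-1).+1%N = (q ^ gap V i)%N.
Proof.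
move=> hi; have [i0 lein] := andP hi.
have sub : (Vpart V i.-1 <= Vpart V i)%VS by rewrite Vpart_sub ?leq_pred // /Ndim; move: lein; dimlia.
rewrite paths_same // (introT (agree_offP _ _ _)) // mul1n /gap -(card_hyperplanes hB sub).
congr (_ * _).+1%N; apply: eq_card => S; rewrite !inE andbb /replaceable.
case: (boolP (codim1 S (Vpart V i))) => SA; rewrite ?andbF //= andbT.
have /andP[_] := replaceable_part V hi.
case: ltnP => _ h; rewrite andb_idr // => _; first exact: subv_trans (codim1_sub SA) h.
by apply: subv_trans (codim1_sub SA) (subv_trans h (orthov_sub _ (codim1_sub SA))).
Qed.

End Relations.

(** * The last node *)

Section LastNode.
Variables (n d : nat) (F : finFieldType).
Local Notation U := 'rV[F]_(Ndim d).
Variable B : {symmetric U}.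
Local Notation "S ^!" := (orthov B S).
Local Notation flag := (flag n B).
Local Notation q := #|F|.
Implicit Types (V W : flag) (L A C S T : {vspace U}).
Hypotheses (hB : nondegenerate B) (hF : odd #|F|).

(** This is [replaceable] at the last place, with [L] standing for [V_(n-1)]. *)
Definition isotropic_over L S := (L <= S)%VS && (S <= S^!)%VS.

Lemma card_set_eq_if (X : {vspace U}) (P : pred {vspace U}) (b : bool) :
  (forall S, P S -> S = X) -> P X = b -> #|[set S | P S]| = b.
Proof.
move=> PX <-; case: (boolP (P X)) => h.
  apply/eqP/cards1P; exists X; apply/setP => S; rewrite !inE.
  by apply/idP/eqP => [/PX|->].
apply/eqP; rewrite cards_eq0 -subset0; apply/subsetP => S; rewrite !inE => PS.
by rewrite -(PX S) // PS in h.
Qed.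

Lemma isotropic_sub L S T : (L <= S)%VS -> (S <= T)%VS -> (T <= T^!)%VS -> isotropic_over L S.
Proof.
by move=> LS ST hT; rewrite /isotropic_over LS (subv_trans ST (subv_trans hT (orthov_sub _ ST))).
Qed.

Lemma geometricS N M k a : (1 < k)%N ->
  (N * k.-1).+1%N = (k ^ a)%N -> (M * k.-1).+1%N = (k ^ a.+1)%N -> M = (N + k ^ a)%N.
Proof.
rewrite expnS; move: (k ^ a)%N => Q; case: k => // k; rewrite ltnS /= mulSn => k0 eqN eqM.
by apply/eqP; rewrite -(eqn_pmul2r k0) mulnDl; move: eqN eqM; rewrite [(k * Q)%N]mulnC; dimlia.
Qed.

Lemma hyperplanes_sum A T C : codim1 A C -> codim1 T C -> T <> A -> (A + T)%VS = C.
Proof.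
move=> AC TC neTA; have sub : (A + T <= C)%VS by rewrite subv_add !codim1_sub.
apply/eqP; rewrite -(geq_leqif (dimv_leqif_eq sub)) (codim1_dim AC) ltnNge.
apply/negP; rewrite (geq_leqif (dimv_leqif_eq (addvSl A T))) => /eqP defA.
have TA : (T <= A)%VS by rewrite defA addvSr.
apply: neTA; apply/eqP; rewrite -(geq_leqif (dimv_leqif_eq TA)) -ltnS.
by rewrite -(codim1_dim AC) (codim1_dim TC).
Qed.

(** The term [T = A] is given by [card_isotropic]; every other hyperplane [T] of [C] forces
    [S = A + T = C] and contributes 1. Hyperplanes of [C] over [L] outnumber those of [A] over [L]
    by [q ^ (\dim A - \dim L)], whence the second power of [q]. *)
Lemma sum_incident L A C : codim1 A C -> (L <= A)%VS -> (C <= C^!)%VS ->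
  (q * #|[set S | [&& isotropic_over L S, codim2 A S & codim1 C S]]|
   + #|[set S | [&& isotropic_over L S, codim1 S A & codim2 S C]]|
   + (q ^ (Ndim d - \dim C - \dim C) + q ^ (\dim C - \dim L).-1)
   = \sum_(T | isotropic_over L T && codim1 T C)
       #|[set S | [&& isotropic_over L S, codim1 A S & codim1 T S]]|)%N.
Proof.
move=> AC LA hC; have sAC := codim1_sub AC; have dC := codim1_dim AC.
have isoA : isotropic_over L A by apply: isotropic_sub hC.
rewrite (bigD1 A) ?isoA //=.
have -> : [set S | [&& isotropic_over L S, codim2 A S & codim1 C S]]
          = [set S | codim1 C S && (S <= S^!)%VS].
  apply/setP => S; rewrite !inE /isotropic_over.
  case: (boolP (codim1 C S)) => CS; rewrite ?andbF //= (codim1_trans AC CS) !andbT.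
  by rewrite (subv_trans LA (subv_trans sAC (codim1_sub CS))).
have -> : [set S | [&& isotropic_over L S, codim1 A S & codim1 A S]]
          = [set S | codim1 A S && (S <= S^!)%VS].
  apply/setP => S; rewrite !inE /isotropic_over andbb.
  by case: (boolP (codim1 A S)) => AS; rewrite ?andbF //= andbT (subv_trans LA (codim1_sub AS)).
rewrite (card_isotropic hB hF AC hC).
have -> : [set S | [&& isotropic_over L S, codim1 S A & codim2 S C]]
          = [set S | codim1 S A && (L <= S)%VS].
  apply/setP => S; rewrite !inE; case: (boolP (codim1 S A)) => SA; rewrite ?andbF //=.
  rewrite (codim1_trans SA AC) andbT /isotropic_over andb_idr // => LS.
  by have /andP[] := isotropic_sub LS (subv_trans (codim1_sub SA) sAC) hC.
have -> : (\sum_(T | isotropic_over L T && codim1 T C && (T != A))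
       #|[set S | [&& isotropic_over L S, codim1 A S & codim1 T S]]|
    = #|[set T | codim1 T C && (L <= T)%VS]| - 1)%N.
  rewrite (eq_bigr (fun=> 1%N)) => [|T /andP[/andP[isoT TC] /eqP neTA]].
    rewrite sum1_card [in RHS](cardsD1 A) inE AC LA addKn -cardsE.
    apply: eq_card => T; rewrite !inE unfold_in andbC; congr (_ && _).
    rewrite andbC; case: (boolP (codim1 T C)) => TC //=.
    apply/idP/idP => [/andP[]// | LT]; exact: isotropic_sub LT (codim1_sub TC) hC.
  apply: (@card_set_eq_if C _ true) => [S /and3P[_ AS TS]|].
    have AT := hyperplanes_sum AC TC neTA.
    have sub : (C <= S)%VS by rewrite -AT subv_add !codim1_sub.
    by apply/esym/eqP; rewrite -(geq_leqif (dimv_leqif_eq sub)) (codim1_dim AS) dC.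
  by rewrite AC TC /isotropic_over (subv_trans LA sAC) hC.
have := card_hyperplanes hB LA; have := card_hyperplanes hB (subv_trans LA sAC).
have -> : (\dim C - \dim L = (\dim A - \dim L).+1)%N by rewrite dC subSn ?dimvS.
move=> cM cN; rewrite (geometricS (finNzRing_gt1 F) cN cM).
have : (0 < q ^ (\dim A - \dim L))%N by rewrite expn_gt0 ltnW ?finNzRing_gt1.
rewrite /=; set Q := (q ^ (\dim A - \dim L))%N; set X := (q ^ (_ - _ - _))%N.
dimlia.
Qed.

(** The subspace [T] of [C] is already orthogonal to [C], so a single vector of [A] outside [T]
    imposes the one remaining condition. *)
Lemma dim_cap_orthov_codim1 A C T : codim1 T A -> (T <= C)%VS -> (C <= C^!)%VS ->
  ~~ (A <= C^!)%VS -> \dim C = (\dim (C :&: A^!)).+1.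
Proof.
move=> TA TC hC; have [x xT ->] := codim1_witness TA.
have TCo : (T <= C^!)%VS := subv_trans TC hC.
rewrite subv_add TCo -memvE /= orthovDI capvA => xC.
have -> : (C :&: T^!)%VS = C by apply/capv_idPl; rewrite orthov_sym.
have := eq_dim_orthov1 xC; have := dimvS (capvSl C (<[x]>)^!).
have : (0 < \dim C)%N.
  rewrite lt0n dimv_eq0; apply: contra xC => /eqP ->; by rewrite orthov0 memvf.
by dimlia.
Qed.

(** Everything vanishes unless [I = A :&: C] has codimension 1 in [A] and 2 in [C]. Then the first
    set is at most [A + C], which is isotropic exactly when [A] and [C] are orthogonal, and the
    second is [I]. The sum counts the lines of [(C :&: A^!) / I]: there are [q + 1] of them if [A]
    and [C] are orthogonal, and one otherwise. *)
Lemma sum_skew L A C : ~~ codim1 A C -> (L <= A)%VS -> (L <= C)%VS ->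
    (A <= A^!)%VS -> (C <= C^!)%VS ->
  (q * #|[set S | [&& isotropic_over L S, codim2 A S & codim1 C S]]|
   + #|[set S | [&& isotropic_over L S, codim1 S A & codim2 S C]]|
   = \sum_(T | isotropic_over L T && codim1 T C)
       #|[set S | [&& isotropic_over L S, codim1 A S & codim1 T S]]|)%N.
Proof.
move=> nAC LA LC hA hC; set I := (A :&: C)%VS.
have LI : (L <= I)%VS by rewrite subv_cap LA.
have dim_sum := dimv_sum_cap A C.
(* Where the dimensions would allow [A] to be a hyperplane of [C], the hypothesis makes the
   intersection proper. *)
have dim_cap : \dim C = (\dim A).+1 -> (\dim I < \dim A)%N.
  move=> dC; rewrite ltnNge; apply: contra nAC.
  rewrite (geq_leqif (dimv_leqif_eq (capvSl A C))) => /eqP defA.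
  by rewrite /codim1 -defA capvSr defA dC eqxx.
pose b := codim1 I A && codim2 I C.
have bE : b = (\dim A == (\dim I).+1) && (\dim C == (\dim I).+2).
  by rewrite /b /codim1 /codim2 capvSl capvSr.
have sumAC S : codim2 A S -> codim1 C S -> b /\ S = (A + C)%VS.
  move=> /andP[AS /eqP dA] /andP[CS /eqP dC].
  have sub : (A + C <= S)%VS by rewrite subv_add AS.
  split; first by rewrite bE; move: dim_sum dim_cap dA dC (dimvS sub); rewrite -/I; dimlia.
  apply/esym/eqP; rewrite -(geq_leqif (dimv_leqif_eq sub)).
  by move: dim_sum dim_cap dA dC; rewrite -/I; dimlia.
have capAC S : codim1 S A -> codim2 S C -> b /\ S = I.
  move=> /andP[SA /eqP dA] /andP[SC /eqP dC].
  have sub : (S <= I)%VS by rewrite subv_cap SA.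
  split; first by rewrite bE; move: dim_cap dA dC (dimvS sub); dimlia.
  apply/eqP; rewrite -(geq_leqif (dimv_leqif_eq sub)).
  by move: dim_cap dA dC; dimlia.
have sumAT T S : codim1 T C -> codim1 A S -> codim1 T S -> [/\ b, codim1 I T & S = (A + T)%VS].
  move=> /andP[TC /eqP dC] /andP[AS /eqP dA] /andP[TS /eqP dT].
  have dTA : \dim T = \dim A by move: dA; rewrite dT => /succn_inj.
  have sub : (A + T <= S)%VS by rewrite subv_add AS.
  have capT : (A :&: T <= I)%VS by rewrite capvS.
  have dim_sumT := dimv_sum_cap A T.
  have big : (\dim A < \dim (A + T))%N.
    rewrite ltnNge; apply/negP; rewrite (geq_leqif (dimv_leqif_eq (addvSl A T))) => /eqP defA.
    have TA : (T <= A)%VS by rewrite defA addvSr.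
    have AT : A = T by apply/esym/eqP; rewrite -(geq_leqif (dimv_leqif_eq TA)) dTA.
    by move: dim_cap; rewrite /I AT (capv_idPl TC) dC ltnn => /(_ erefl).
  have IT : I = (A :&: T)%VS.
    apply/esym/eqP; rewrite -(geq_leqif (dimv_leqif_eq capT)).
    by move: (dimvS sub) (dimvS capT) dim_sumT dim_cap dA dC dT big; dimlia.
  split.
  - by rewrite bE IT; move: (dimvS sub) dim_sumT dA dC dT big; dimlia.
  - rewrite /codim1 IT capvSr /=.
    by move: (dimvS sub) dim_sumT dA dC dT big; dimlia.
  apply/esym/eqP; rewrite -(geq_leqif (dimv_leqif_eq sub)).
  by move: dA big; dimlia.
have -> : #|[set S | [&& isotropic_over L S, codim2 A S & codim1 C S]]| = (b && (A <= C^!)%VS).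
  apply: (card_set_eq_if (X := (A + C)%VS)).
    by move=> S /and3P[_ h1 h2]; have [] := sumAC S h1 h2.
  rewrite /isotropic_over (subv_trans LA (addvSl _ _)) orthoDv !orthovD hA hC andbT /=.
  rewrite [(C <= A^!)%VS]orthov_sym andbb andbC; congr (_ && _).
  by rewrite bE /codim1 /codim2 addvSl addvSr /=; move: dim_sum; rewrite -/I; dimlia.
have -> : #|[set S | [&& isotropic_over L S, codim1 S A & codim2 S C]]| = b.
  apply: (card_set_eq_if (X := I)).
    by move=> S /and3P[_ h1 h2]; have [] := capAC S h1 h2.
  by rewrite (isotropic_sub LI (capvSr _ _) hC).
have -> : (\sum_(T | isotropic_over L T && codim1 T C)
       #|[set S | [&& isotropic_over L S, codim1 A S & codim1 T S]]|
    = b * #|[set T | codim1 I T && (T <= C :&: A^!)%VS]|)%N.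
  case: (boolP b) => [hb|nb]; last first.
    rewrite mul0n big1 // => T /andP[_ TC]; apply/eqP; rewrite cards_eq0 -subset0.
    apply/subsetP => S; rewrite !inE => /and3P[_ AS TS].
    by have [] := sumAT T S TC AS TS; rewrite (negbTE nb).
  move: (hb); rewrite bE => /andP[/eqP dA /eqP dC].
  rewrite mul1n (eq_bigr (fun T => nat_of_bool (codim1 I T && (T <= A^!)%VS))); last first.
    move=> T /andP[/andP[LT hT] TC].
    apply: (card_set_eq_if (X := (A + T)%VS)).
      by move=> S /and3P[_ h1 h2]; have [] := sumAT T S TC h1 h2.
    rewrite /isotropic_over (subv_trans LA (addvSl _ _)) orthoDv !orthovD hA hT andbT /=.
    rewrite [(T <= A^!)%VS]orthov_sym andbb andbC; congr (_ && _).
    apply/andP/idP => [[h1 h2]|IT]; first by have [] := sumAT T _ TC h1 h2.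
    have defI : (A :&: T = I)%VS.
      apply: subv_anti.
      apply/andP; split; first exact: capvS (subvv _) (codim1_sub TC).
      by rewrite subv_cap capvSl codim1_sub.
    have := dimv_sum_cap A T; rewrite defI /codim1 addvSl addvSr (codim1_dim IT) dA /=.
    by dimlia.
  rewrite -big_mkcondr /= sum1_card -cardsE; apply: eq_card => T; rewrite !inE unfold_in subv_cap.
  apply/idP/idP => [/and3P[/andP[_ /codim1_sub ->] -> ->] // | /and3P[IT TC ->]].
  rewrite IT (isotropic_sub (subv_trans LI (codim1_sub IT)) TC hC) /codim1 TC dC.
  by rewrite (codim1_dim IT) eqxx.
case: (boolP b) => [hb|_]; last by rewrite muln0.
move: (hb); rewrite bE => /andP[/eqP dA /eqP dC]; have /andP[IA _] := hb.
have IC := capvSr A C; have q1 := finNzRing_gt1 F.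
have := @card_lines _ _ I (C :&: A^!)%VS.
rewrite subv_cap IC (subv_trans (capvSl _ _) hA) => /(_ isT).
rewrite mul1n; case: (boolP (A <= C^!)%VS) => ACo.
  have -> : (C :&: A^!)%VS = C by apply/capv_idPl; rewrite orthov_sym.
  by rewrite dC -addn2 addKn => /(geometric2 q1) ->; rewrite muln1 addn1.
have := dim_cap_orthov_codim1 IA IC hC ACo; rewrite dC => /succn_inj <-.
by rewrite subSnn muln0 => /(geometric1 q1) ->.
Qed.

Lemma sum_agree_off i V (f : {vspace U} -> nat) : (0 < i <= n)%N ->
  (\sum_(W | agree_off i V W) f (Vpart W i) = \sum_(S | replaceable i V S) f S)%N.
Proof.
move=> hi; rewrite (partition_big (fun W => Vpart W i) (replaceable i V)) /=; last first.
  by move=> W VW; rewrite (replaceable_agree hi VW) replaceable_part.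
apply: eq_bigr => S hS; rewrite (eq_bigr (fun=> f S)); last by move=> W /andP[_ /eqP ->].
rewrite sum_nat_const -[RHS]mul1n -cardsE; congr (_ * _)%N.
rewrite (card_agree_off hB V (pred1 S)) //.
by rewrite (card_set_eq_if (X := S) (b := true)) /= ?hS ?eqxx // => T /andP[_ /eqP].
Qed.

(** The flag [W] before the final upward move has the space [T] of [sum_incident] and [sum_skew] as
    its [n]-th part. The powers of [q] appear only when [V'] is reached from [V] by one upward
    move. *)
Lemma paths_last V V' : (0 < n)%N ->
  (q * paths (up2 n) (down n) V V' + paths (down n) (up2 n) V V'
   + up n V V' * (q ^ gap V' n.+1 + q ^ (gap V' n).-1)
   = \sum_W paths (up n) (down n) V W * up n W V')%N.
Proof.
move=> n0; have hn : (0 < n <= n)%N by rewrite n0 leqnn.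
rewrite !paths_same // /up /step; set A := Vpart V n; set C := Vpart V' n.
under eq_bigr do rewrite paths_same //.
case: (boolP (agree_off n V V')) => VV'; rewrite ?mul0n ?muln0 ?mul1n /=; last first.
  apply/esym; apply: big1 => W _; case: (boolP (agree_off n V W)) => //= VW.
  by rewrite (agree_off_trans _ VW) (negbTE VV') /= muln0.
set L := Vpart V n.-1.
have sub W : (Vpart W n.-1 <= Vpart W n)%VS by rewrite Vpart_sub ?leq_pred // /Ndim; dimlia.
have eqL : Vpart V' n.-1 = L by rewrite -(agree_offP _ _ _ VV') ?leq_pred //; move: n0; dimlia.
have LA : (L <= A)%VS := sub V.
have LC : (L <= C)%VS by rewrite -eqL sub.
have hA := Vpart_isotropic V (leqnn n); have hC := Vpart_isotropic V' (leqnn n).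
have repE S : replaceable n V S = isotropic_over L S by rewrite /replaceable ltnn.
have set_repE (P : pred {vspace U}) :
    #|[set S | replaceable n V S && P S]| = #|[set S | isotropic_over L S && P S]|.
  by apply: eq_card => S; rewrite !inE repE.
rewrite !set_repE.
(* Since [V'_(n+1)] is the orthogonal of [C], this gap is the dimension of the quadratic space
   [C^! / C], the exponent [m] of [card_isotropic]. *)
have -> : gap V' n.+1 = (Ndim d - \dim C - \dim C)%N.
  rewrite /gap (Vpart_orthov V' (k := n.+1)) ?dim_orthov //; last by rewrite /Ndim; dimlia.
  by congr (_ - \dim (Vpart _ _) - _)%N; rewrite /Ndim; dimlia.
have -> : gap V' n = (\dim C - \dim L)%N by rewrite /gap eqL.
transitivity (\sum_(T | isotropic_over L T && codim1 T C)
       #|[set S | [&& isotropic_over L S, codim1 A S & codim1 T S]]|)%N.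
  case: (boolP (codim1 A C)) => AC; rewrite ?mul1n ?mul0n ?addn0; first exact: sum_incident.
  exact: sum_skew.
rewrite big_mkcondr -(eq_bigl _ _ repE) -(sum_agree_off V (fun T => if codim1 T C then
  #|[set S | [&& isotropic_over L S, codim1 A S & codim1 T S]]| else 0%N) hn) /=.
rewrite [LHS]big_mkcond; apply: eq_bigr => W _.
case: (boolP (agree_off n V W)) => VW; rewrite ?mul0n // mul1n (agree_off_trans _ VW) VV' /=.
by case: (codim1 _ C); rewrite ?muln0 // muln1 set_repE.
Qed.
End LastNode.

(** * Matrices indexed by flags *)

Section Operators.
Variables (n d : nat) (F : finFieldType).
Local Notation U := 'rV[F]_(Ndim d).
Variable B : {symmetric U}.
Local Notation flag := (flag n B).
Local Notation q := #|F|.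
Variables (K : fieldType) (v : K).
Implicit Types (V W : flag) (f h : flag -> flag -> K) (r : flag -> flag -> bool).
Hypotheses (v0 : v != 0) (v2 : v ^+ 2 = q%:R).
Hypotheses (hB : nondegenerate B) (hF : odd #|F|).

Definition kmx f : 'M[K]_#|{: flag}| := \matrix_(x, y) f (enum_val x) (enum_val y).

Lemma eq_kmx f h : (forall V W, f V W = h V W) -> kmx f = kmx h.
Proof. by move=> E; apply/matrixP => x y; rewrite !mxE. Qed.

Lemma kmx_inj f h : kmx f = kmx h -> forall V W, f V W = h V W.
Proof.
by move=> /matrixP E V W; have := E (enum_rank V) (enum_rank W); rewrite !mxE !enum_rankK.
Qed.

Lemma kmxM f h : kmx f *m kmx h = kmx (fun V V' => \sum_W f V W * h W V').
Proof.
apply/matrixP => x y; rewrite !mxE (reindex enum_rank) /=; last first.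
  by apply: onW_bij; exact: enum_rank_bij.
by apply: eq_bigr => W _; rewrite !mxE enum_rankK.
Qed.

Lemma kmxD f h : kmx f + kmx h = kmx (fun V W => f V W + h V W).
Proof. by apply/matrixP => x y; rewrite !mxE. Qed.

Lemma kmxZ a f : a *: kmx f = kmx (fun V W => a * f V W).
Proof. by apply/matrixP => x y; rewrite !mxE. Qed.

Definition rel_op r := kmx (fun V W => (r V W)%:R).
Definition diag_op (w : flag -> K) := kmx (fun V W => if V == W then w W else 0).

Lemma rel_opM r r' : rel_op r *m rel_op r' = kmx (fun V V' => (paths r r' V V')%:R).
Proof.
rewrite kmxM; apply: eq_kmx => V V'; rewrite /paths -sum1dep_card natr_sum.
rewrite [RHS]big_mkcond; apply: eq_bigr => W _.
by case: (r V W); case: (r' W V'); rewrite ?mulr1 ?mulr0 ?mul0r.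
Qed.

Lemma diag_opMl w f : diag_op w *m kmx f = kmx (fun V V' => w V * f V V').
Proof.
rewrite kmxM; apply: eq_kmx => V V'; rewrite (bigD1 V) //= eqxx big1 ?addr0 // => W neW.
by rewrite eq_sym (negbTE neW) mul0r.
Qed.

Lemma diag_opMr w f : kmx f *m diag_op w = kmx (fun V V' => f V V' * w V').
Proof.
rewrite kmxM; apply: eq_kmx => V V'; rewrite (bigD1 V') //= eqxx big1 ?addr0 // => W neW.
by rewrite (negbTE neW) mulr0.
Qed.

Lemma diag_opM w w' : diag_op w *m diag_op w' = diag_op (fun V => w V * w' V).
Proof.
rewrite diag_opMl; apply: eq_kmx => V V'.
by case: eqP => [->|]; rewrite ?mulr0.
Qed.

Lemma diag_op1 w : (forall V, w V = 1) -> diag_op w = 1%:M.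
Proof.
move=> w1; apply/matrixP => x y; rewrite !mxE w1 (inj_eq enum_val_inj).
by case: eqP.
Qed.

Definition K_op a : 'M[K]_#|{: flag}| := diag_op (fun V => v ^ (- (gap V a)%:Z)).
Definition Kinv_op a : 'M[K]_#|{: flag}| := diag_op (fun V => v ^ (gap V a)%:Z).
Definition e_op i := rel_op (@up n d F B i) *m K_op i.+1.
Definition f_op i := rel_op (@down n d F B i) *m K_op i.

Lemma K_opC a b : K_op a *m K_op b = K_op b *m K_op a.
Proof. by rewrite !diag_opM; apply: eq_kmx => V W; rewrite mulrC. Qed.

Lemma KKinv_op a : K_op a *m Kinv_op a = 1%:M.
Proof. by rewrite diag_opM diag_op1 // => V; rewrite -expfzDr // addNr. Qed.

Lemma KinvK_op a : Kinv_op a *m K_op a = 1%:M.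
Proof. by rewrite diag_opM diag_op1 // => V; rewrite -expfzDr // subrr. Qed.

(* The exponent of v in the commutation of d_a with E_j; the factor 2 comes from
   V_(n+1) being the orthogonal of V_n. *)
Definition weight a j : int :=
  (a == j)%:Z - (a == j.+1)%:Z * (if j == n then 2 else 1).

Lemma gap_up a j V W : (0 < a <= n.+1)%N -> (0 < j <= n)%N -> up j V W ->
  (gap W a)%:Z = (gap V a)%:Z + weight a j.
Proof.
move=> /andP[a0 an] /andP[j0 jn] /andP[/agree_offP VW /codim1_dim VWj].
have dim_le k : (k <= n)%N -> \dim (Vpart W k) = (\dim (Vpart V k) + (k == j))%N.
  move=> kn; case: eqP => [->|kj]; first by rewrite VWj addn1.
  by rewrite VW // addn0.
have dim_mid (X : flag) : \dim (Vpart X n.+1) = (Ndim d - \dim (Vpart X n))%N.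
  rewrite (Vpart_orthov X (k := n.+1)) ?dim_orthov //; last by rewrite /Ndim; dimlia.
  by congr (_ - \dim (Vpart _ _))%N; rewrite /Ndim; dimlia.
have sub (X : flag) : (\dim (Vpart X a.-1) <= \dim (Vpart X a))%N.
  by rewrite dimvS // Vpart_sub ?leq_pred // /Ndim; move: an j0 jn; dimlia.
have dim_le1 : \dim (Vpart W a.-1) = (\dim (Vpart V a.-1) + (a.-1 == j))%N.
  by apply: dim_le; move: an; dimlia.
have dim_n := dim_le n (leqnn n).
rewrite /gap /weight; move: (sub V) (sub W); rewrite dim_le1.
have [ean|nan] := eqVneq a n.+1.
  have := dimv_le (Vpart W n); have := dimv_le (Vpart V n).
  rewrite ean !dim_mid dim_n /= !eqSS; move: jn.
  by clear; case: ifP; dimlia.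
rewrite dim_le; last by move: an nan; dimlia.
by move: a0 an j0 jn nan; clear; case: ifP; dimlia.
Qed.

Lemma K_up a j : (0 < a <= n.+1)%N -> (0 < j <= n)%N ->
  K_op a *m rel_op (@up n d F B j) = v ^ weight a j *: (rel_op (@up n d F B j) *m K_op a).
Proof.
move=> ha hj; rewrite diag_opMl diag_opMr kmxZ; apply: eq_kmx => V W.
case: (boolP (up j V W)) => h; rewrite ?mul0r ?mulr0 // mul1r mulr1.
by rewrite (gap_up ha hj h) -expfzDr //; congr (_ ^ _); ring.
Qed.

Lemma downE j V W : @down n d F B j V W = up j W V.
Proof. by rewrite /down /up /step agree_offC. Qed.

Lemma K_down a j : (0 < a <= n.+1)%N -> (0 < j <= n)%N ->
  K_op a *m rel_op (@down n d F B j) = v ^ (- weight a j) *: (rel_op (@down n d F B j) *m K_op a).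
Proof.
move=> ha hj; rewrite diag_opMl diag_opMr kmxZ; apply: eq_kmx => V W.
case: (boolP (down j V W)) => h; rewrite ?mul0r ?mulr0 // mul1r mulr1.
rewrite downE in h.
by rewrite (gap_up ha hj h) -expfzDr //; congr (_ ^ _); ring.
Qed.

Lemma rel_op_down j : rel_op (@down n d F B j) = (rel_op (@up n d F B j))^T.
Proof. by apply/matrixP => x y; rewrite !mxE downE. Qed.

Local Notation E i := (rel_op (@up n d F B i)).
Local Notation Ft i := (rel_op (@down n d F B i)).

Lemma rel_step_comm i j P Q : (0 < i <= n)%N -> (0 < j <= n)%N -> i <> j ->
    (forall V V' : flag, step2 i j P Q V V' = step2 j i Q P V V') ->
  rel_op (@step n d F B i P) *m rel_op (step j Q) = rel_op (step j Q) *m rel_op (step i P).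
Proof.
move=> hi hj ij eqPQ; rewrite !rel_opM; apply: eq_kmx => V V'.
by rewrite !paths_other // ?eqPQ //; apply: nesym.
Qed.

Lemma up_up_comm i j : (0 < i <= n)%N -> (0 < j <= n)%N -> i <> j -> i <> j.+1 -> j <> i.+1 ->
  E i *m E j = E j *m E i.
Proof.
move=> hi hj ij /eqP ij1 /eqP ji1; apply: rel_step_comm => // V V'.
rewrite /step2 agree_off2C (negbTE ij1) (negbTE ji1) /= !andbT.
by do !bool_congr; rewrite andbC.
Qed.

(** Even at adjacent places the incidences of [step2] follow from the inclusions in [V] or [V'] and
    the directions of the moves. For two upward moves this fails in one order, which is why Serre
    relations appear there. *)
Lemma up_down_comm i j : (0 < i <= n)%N -> (0 < j <= n)%N -> i <> j ->
  E i *m Ft j = Ft j *m E i.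
Proof.
move=> hi hj ij; apply: rel_step_comm => // V V'; rewrite /step2 agree_off2C.
have [_ ni] := andP hi; have [_ nj] := andP hj.
case: (agree_off2 _ _ _ _) => //=.
case: (boolP (codim1 (Vpart V i) (Vpart V' i))) => [/codim1_sub Ai|]; rewrite ?andbF //=.
case: (boolP (codim1 (Vpart V' j) (Vpart V j))) => [/codim1_sub Aj|] //=.
have [ji|ji] := eqVneq j i.+1.
  subst j; have iN : (i.+1 <= Ndim n)%N by rewrite /Ndim; move: nj; dimlia.
  rewrite (ltn_eqF (ltnW (ltnSn i.+1))) /= andbT.
  rewrite (subv_trans (Vpart_sub V' (leqnSn i) iN) Aj).
  by rewrite (subv_trans Ai (Vpart_sub V' (leqnSn i) iN)).
have [ij1|ij1] := eqVneq i j.+1 => //=.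
subst i; have jN : (j.+1 <= Ndim n)%N by rewrite /Ndim; move: ni; dimlia.
rewrite !andbT (subv_trans (Vpart_sub V (leqnSn j) jN) Ai).
by rewrite (subv_trans Aj (Vpart_sub V (leqnSn j) jN)).
Qed.

Lemma up_up i : (0 < i <= n)%N -> E i *m E i = q.+1%:R *: rel_op (@up2 n d F B i).
Proof.
move=> hi; rewrite rel_opM kmxZ; apply: eq_kmx => V V'.
by rewrite paths_up2 // natrM.
Qed.

Lemma up_serre_next i : (0 < i)%N -> (i < n)%N ->
  q%:R *: (E i *m E i *m E i.+1) + E i.+1 *m (E i *m E i) = q.+1%:R *: (E i *m E i.+1 *m E i).
Proof.
move=> i0 ltin; have hi : (0 < i <= n)%N by rewrite i0 ltnW.
rewrite up_up // -scalemxAl -scalemxAr scalerA [q%:R * _]mulrC -scalerA -scalerDr.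
congr (_ *: _).
have -> : E i *m E i.+1 = rel_op (step2 i i.+1 (@codim1 d F) (@codim1 d F)).
  by rewrite rel_opM; apply: eq_kmx => V V'; rewrite paths_other // => /n_Sn.
rewrite !rel_opM kmxZ kmxD; apply: eq_kmx => V V'.
rewrite -serre_up_next // !paths_other //; try by [move=> /n_Sn | move=> /esym/n_Sn].
by rewrite natrD natrM.
Qed.

Lemma up_serre_prev j : (0 < j)%N -> (j < n)%N ->
  E j.+1 *m E j.+1 *m E j + q%:R *: (E j *m (E j.+1 *m E j.+1))
  = q.+1%:R *: (E j.+1 *m E j *m E j.+1).
Proof.
move=> j0 ltjn; have hj : (0 < j <= n)%N by rewrite j0 ltnW.
rewrite up_up // -scalemxAl -scalemxAr scalerA [q%:R * _]mulrC -scalerA -scalerDr.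
congr (_ *: _).
have -> : E j.+1 *m E j = rel_op (step2 j.+1 j (@codim1 d F) (@codim1 d F)).
  by rewrite rel_opM; apply: eq_kmx => V V'; rewrite paths_other // => /esym/n_Sn.
rewrite !rel_opM kmxZ kmxD; apply: eq_kmx => V V'.
rewrite -serre_up_prev // !paths_other //; try by [move=> /n_Sn | move=> /esym/n_Sn].
by rewrite natrD natrM.
Qed.

(** Off the diagonal the two products agree. On it the factor [q - 1] clears the geometric sums,
    [(q - 1) * N = q ^ a - 1], and the two constants cancel. *)
Lemma up_down_same i : (0 < i < n)%N ->
  (q%:R - 1) *: (E i *m Ft i - Ft i *m E i)
  = diag_op (fun V => v ^ (2 * (gap V i.+1)%:Z) - v ^ (2 * (gap V i)%:Z)).
Proof.
move=> hi; have [i0 ltin] := andP hi.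
rewrite !rel_opM -scaleN1r kmxZ kmxD kmxZ; apply: eq_kmx => V V'.
case: eqP => [<-|/eqP neV]; last by rewrite up_down_offdiag // mulN1r subrr mulr0.
have q_geom N a : (N * q.-1).+1 = (q ^ a)%N -> (q%:R - 1) * N%:R = v ^ (2 * a%:Z) - 1 :> K.
  move=> eqN; rewrite -exprz_exp -!exprnP v2 -natrX -eqN -[in q%:R](prednK (ltnW (finNzRing_gt1 F))).
  by rewrite -[q.-1.+1]addn1 natrD addrK mulrC -natrM -[(N * _).+1]addn1 natrD addrK.
rewrite mulN1r mulrBr (q_geom _ _ (up_down_diag hB V hi)).
have hi' : (0 < i <= n)%N by rewrite i0 ltnW.
rewrite (q_geom _ _ (down_up_diag hB V hi')).
by rewrite opprB addrA subrK.
Qed.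

Lemma up_down_last : (0 < n)%N ->
  q%:R *: (E n *m E n *m Ft n) + Ft n *m (E n *m E n)
  = q.+1%:R *: (E n *m Ft n *m E n
      - E n *m diag_op (fun V => v ^ (2 * (gap V n.+1)%:Z) + v ^ (2 * (gap V n)%:Z - 2))).
Proof.
move=> n0; have hn : (0 < n <= n)%N by rewrite n0 leqnn.
rewrite up_up // -scalemxAl -scalemxAr scalerA [q%:R * _]mulrC -scalerA -scalerDr.
congr (_ *: _); apply/eqP; rewrite eq_sym subr_eq; apply/eqP.
rewrite !rel_opM diag_opMr kmxM kmxZ !kmxD; apply: eq_kmx => V V'.
rewrite (eq_bigr (fun W => (paths (up n) (down n) V W * up n W V')%:R)); last first.
  by move=> W _; rewrite natrM.
rewrite -natr_sum -paths_last // !natrD !natrM natrD !natrX.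
congr (_ + _); case: (boolP (up n V V')) => h; rewrite ?mul0r // !mul1r -v2.
(* Needed to read the truncated [(gap V' n).-1] as an integer exponent: the move up makes [V'_n]
   strictly larger than [V_n], which contains [V_(n-1) = V'_(n-1)]. *)
have gap_pos : (0 < gap V' n)%N.
  have [VV' /codim1_dim dV'] := andP h; rewrite /gap subn_gt0 dV' ltnS.
  have <- := agree_offP _ _ _ VV' n.-1; rewrite ?leq_pred //; last by move: n0; dimlia.
  by rewrite dimvS // Vpart_sub ?leq_pred // /Ndim; dimlia.
rewrite !exprnP !exprz_exp; congr (_ + _ ^ _).
by move: gap_pos; dimlia.
Qed.

End Operators.

(** * Relations between the matrices of the generators *)

Section OperatorRelations.
Variables (n d : nat) (F : finFieldType).
Local Notation U := 'rV[F]_(Ndim d).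
Variable B : {symmetric U}.
Local Notation flag := (flag n B).
Local Notation q := #|F|.
Variables (K : fieldType) (v : K).
Hypotheses (v0 : v != 0) (v2 : v ^+ 2 = q%:R).
Hypotheses (hB : nondegenerate B) (hF : odd #|F|).

Local Notation E i := (rel_op K (@up n d F B i)).
Local Notation Ft i := (rel_op K (@down n d F B i)).
Local Notation k a := (K_op n B v a).
Local Notation ki a := (Kinv_op n B v a).
Local Notation e i := (e_op n B v i).
Local Notation f i := (f_op n B v i).

Lemma v_unit_expD (a b : int) : v ^ (a + b) = v ^ a * v ^ b.
Proof. exact: expfzDr. Qed.

Lemma v_mul_exp (a : int) : v * v ^ a = v ^ (1 + a).
Proof. by rewrite v_unit_expD expr1z. Qed.

Section Weights.
Variable m : nat.
Implicit Types (X Y Z D : 'M[K]_m) (a b c : int).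

Lemma weight_mul2 X Y D1 D2 a : D1 *m Y = v ^ a *: (Y *m D1) ->
  X *m D1 *m (Y *m D2) = v ^ a *: (X *m Y *m (D1 *m D2)).
Proof. by move=> h; rewrite -[LHS]mulmxA (mulmxA D1) h -scalemxAl -scalemxAr !mulmxA. Qed.

(** The exponents [a], [b], [c] are the costs of moving [D1] past [Y], [D1] past [Z] and [D2] past
    [Z]. *)
Lemma weight_mul3 (s : int) X Y Z D1 D2 D3 a b c :
    D1 *m Y = v ^ a *: (Y *m D1) -> D1 *m Z = v ^ b *: (Z *m D1) ->
    D2 *m Z = v ^ c *: (Z *m D2) -> a + b + c = s ->
  X *m D1 *m (Y *m D2) *m (Z *m D3) = v ^ s *: (X *m Y *m Z *m (D1 *m D2 *m D3)).
Proof.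
move=> h1 h2 h3 <-; rewrite (weight_mul2 _ _ h1) -scalemxAl (@weight_mul2 _ _ _ _ (b + c)).
  by rewrite scalerA -v_unit_expD addrA.
rewrite -(mulmxA D1) h3 -scalemxAr (mulmxA D1) h2 -scalemxAl scalerA.
by rewrite -v_unit_expD [c + b]addrC -mulmxA.
Qed.

(** Since [q = v ^+ 2] and [q + 1 = v * (v + v^-1)], collecting the diagonal matrices with exponents
    [c + 2], [c], [c + 1] absorbs the [q] and turns [q + 1] into the quantum integer 2. *)
Lemma serre_rescale c X Y Z D : q%:R *: X + Y = q.+1%:R *: Z ->
  v ^ (c + 2) *: (X *m D) + v ^ c *: (Y *m D) = (v + v^-1) *: (v ^ (c + 1) *: (Z *m D)).
Proof.
move=> h; rewrite scalerA; have -> : (v + v^-1) * v ^ (c + 1) = v ^ c * q.+1%:R.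
  by rewrite v_unit_expD expr1z mulrCA mulrDl mulVf // -expr2 v2 natr1.
rewrite !scalemxAl -mulmxDl -(scalerA (v ^ c)) -h scalerDr scalerA v_unit_expD.
by rewrite -exprnP v2.
Qed.
End Weights.

Lemma K_op3 a b c : k a *m k b *m k c = k b *m k a *m k c.
Proof. by congr (_ *m _); exact: K_opC. Qed.

Lemma K_op3r a b c : k a *m k b *m k c = k a *m k c *m k b.
Proof. by rewrite -!mulmxA; congr (_ *m _); exact: K_opC. Qed.

Lemma K_conj_e a j : (0 < a <= n.+1)%N -> (0 < j <= n)%N ->
  k a *m e j *m ki a = v ^ weight n a j *: e j.
Proof.
move=> ha hj; rewrite /e_op mulmxA K_up // -!scalemxAl; congr (_ *: _).
by rewrite -!mulmxA (mulmxA (k a)) (K_opC n B v a) -mulmxA KKinv_op // mulmx1.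
Qed.

Lemma K_conj_f a j : (0 < a <= n.+1)%N -> (0 < j <= n)%N ->
  k a *m f j *m ki a = v ^ (- weight n a j) *: f j.
Proof.
move=> ha hj; rewrite /f_op mulmxA K_down // -!scalemxAl; congr (_ *: _).
by rewrite -!mulmxA (mulmxA (k a)) (K_opC n B v a) -mulmxA KKinv_op // mulmx1.
Qed.

Lemma range_up i : (0 < i <= n)%N -> (0 < i <= n.+1)%N.
Proof. by case/andP => ->; exact: leqW. Qed.

Lemma e_comm i j : (0 < i <= n)%N -> (0 < j <= n)%N -> i <> j -> i <> j.+1 -> j <> i.+1 ->
  e i *m e j = e j *m e i.
Proof.
move=> hi hj ij ij1 ji1.
have [_ hi'] := andP hi; have [_ hj'] := andP hj.
rewrite (weight_mul2 _ _ (K_up v0 hB (a := i.+1) hi' hj)).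
rewrite (weight_mul2 _ _ (K_up v0 hB (a := j.+1) hj' hi)).
rewrite (up_up_comm _ hB hi hj) // (K_opC n B v j.+1); congr (_ ^ _ *: _).
by rewrite /weight; move: ij ij1 ji1; clear; dimlia.
Qed.

Lemma f_comm i j : (0 < i <= n)%N -> (0 < j <= n)%N -> i <> j -> i <> j.+1 -> j <> i.+1 ->
  f i *m f j = f j *m f i.
Proof.
move=> hi hj ij ij1 ji1.
rewrite (weight_mul2 _ _ (K_down v0 hB (range_up hi) hj)).
rewrite (weight_mul2 _ _ (K_down v0 hB (range_up hj) hi)).
rewrite !rel_op_down -!trmx_mul (up_up_comm _ hB hj hi) //; try by apply: nesym.
rewrite (K_opC n B v i); congr (_ ^ _ *: _).
by rewrite /weight; move: ij ij1 ji1; clear; dimlia.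
Qed.

Lemma ef_comm i j : (0 < i < n)%N -> (0 < j < n)%N -> i <> j -> e i *m f j = f j *m e i.
Proof.
move=> /andP[i0 hi'] /andP[j0 hj'] ij.
have hi : (0 < i <= n)%N by rewrite i0 ltnW.
have hj : (0 < j <= n)%N by rewrite j0 ltnW.
rewrite (weight_mul2 _ _ (K_down v0 hB (a := i.+1) (ltnW hi') hj)).
rewrite (weight_mul2 _ _ (K_up v0 hB (range_up hj) hi)).
rewrite (up_down_comm _ hB) // (K_opC n B v j); congr (_ ^ _ *: _).
by rewrite /weight (ltn_eqF hi') (ltn_eqF hj'); move: ij; dimlia.
Qed.

Lemma ef_same i : (0 < i < n)%N ->
  (v - v^-1) *: (e i *m f i - f i *m e i) = k i *m ki i.+1 - ki i *m k i.+1.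
Proof.
move=> hi; have [i0 hi'] := andP hi.
have hi1 : (0 < i <= n)%N by rewrite i0 ltnW.
rewrite (weight_mul2 _ _ (K_down v0 hB (a := i.+1) (ltnW hi') hi1)).
rewrite (weight_mul2 _ _ (K_up v0 hB (range_up hi1) hi1)).
have -> : - weight n i.+1 i = 1 by rewrite /weight (ltn_eqF hi'); dimlia.
have -> : weight n i i = 1 by rewrite /weight; clear; dimlia.
rewrite (K_opC n B v i) -scalerBr -mulmxBl scalerA scalemxAl expr1z.
(* Both orders produce the same weight, a single [v], which completes [v - v^-1] to the factor
   [q - 1] of [up_down_same]. *)
have -> : (v - v^-1) * v = q%:R - 1 by rewrite mulrBl mulVf // -expr2 v2.
rewrite (up_down_same v2 hB hi) !diag_opM -[X in _ - X]scale1r -scaleNr kmxZ kmxD /diag_op.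
apply: eq_kmx => V W; case: eqP => _; rewrite ?mulr0 ?addr0 // mulN1r.
rewrite mulrBl -!expfzDr //; congr (_ ^ _ - _ ^ _); dimlia.
Qed.

Lemma weightE i j : weight n i j =
  if i == j then 1 else if i == j.+1 then (if j == n then -2 else -1) else 0.
Proof.
rewrite /weight; have [->|ij] := eqVneq i j; first by rewrite (ltn_eqF (ltnSn j)) mul0r subr0.
by case: eqP => _; rewrite ?mul0r ?subr0 // mul1r sub0r; case: ifP.
Qed.

Local Ltac weight_calc := rewrite !weightE; do ?[case: eqP]; dimlia.

Lemma e_serre_next i : (0 < i)%N -> (i < n)%N ->
  e i *m e i *m e i.+1 + e i.+1 *m (e i *m e i) = (v + v^-1) *: (e i *m e i.+1 *m e i).
Proof.
move=> i0 hi'; have hi : (0 < i <= n)%N by rewrite i0 ltnW.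
have hj : (0 < i.+1 <= n)%N by [].
have Ki j : (0 < j <= n)%N -> _ := fun h => K_up v0 hB (a := i.+1) (ltnW hi') h.
have Kj j : (0 < j <= n)%N -> _ := fun h => K_up v0 hB (a := i.+2) hi' h.
(* The exponents are written as [c + 2], [c], [c + 1] with [c = -1], the shape that [serre_rescale]
   expects. *)
rewrite mulmxA (weight_mul3 (s := -1 + 2) _ _ (Ki _ hi) (Ki _ hj) (Ki _ hj)); last first.
  by move: i0 hi'; weight_calc.
rewrite (weight_mul3 (s := -1) _ _ (Kj _ hi) (Kj _ hi) (Ki _ hi)); last first.
  by move: i0 hi'; weight_calc.
rewrite (weight_mul3 (s := -1 + 1) _ _ (Ki _ hj) (Ki _ hi) (Kj _ hi)); last first.
  by move: i0 hi'; weight_calc.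
rewrite (K_op3r _ i.+2) (K_op3 i.+2) (K_op3r _ i.+2).
by apply: serre_rescale; rewrite -(mulmxA (E i.+1)) up_serre_next.
Qed.

Lemma e_serre_prev j : (0 < j)%N -> (j < n)%N ->
  e j.+1 *m e j.+1 *m e j + e j *m (e j.+1 *m e j.+1) = (v + v^-1) *: (e j.+1 *m e j *m e j.+1).
Proof.
move=> j0 hj'; have hj : (0 < j <= n)%N by rewrite j0 ltnW.
have hi : (0 < j.+1 <= n)%N by [].
have Kj l : (0 < l <= n)%N -> _ := fun h => K_up v0 hB (a := j.+1) (ltnW hj') h.
have Ki l : (0 < l <= n)%N -> _ := fun h => K_up v0 hB (a := j.+2) hj' h.
(* The weight of [k j.+2] against [E j.+1], doubled at the last node; it shifts all three exponents
   alike. *)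
pose c : int := if j.+1 == n then -2 else -1.
rewrite mulmxA (weight_mul3 (s := c) _ _ (Ki _ hi) (Ki _ hj) (Ki _ hj)); last first.
  by rewrite /c; move: j0 hj'; weight_calc.
rewrite (weight_mul3 (s := c + 2) _ _ (Kj _ hi) (Kj _ hi) (Ki _ hi)); last first.
  by rewrite /c; move: j0 hj'; weight_calc.
rewrite (weight_mul3 (s := c + 1) _ _ (Ki _ hj) (Ki _ hi) (Kj _ hi)); last first.
  by rewrite /c; move: j0 hj'; weight_calc.
rewrite (K_op3r _ j.+1) (K_op3 j.+1) (K_op3r _ j.+1) addrC.
by apply: serre_rescale; rewrite -(mulmxA (E j)) addrC up_serre_prev.
Qed.

Lemma f_serre_next i : (0 < i)%N -> (i < n)%N ->
  f i *m f i *m f i.+1 + f i.+1 *m (f i *m f i) = (v + v^-1) *: (f i *m f i.+1 *m f i).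
Proof.
move=> i0 hi'; have hi : (0 < i <= n)%N by rewrite i0 ltnW.
have hj : (0 < i.+1 <= n)%N by [].
have Ki j : (0 < j <= n)%N -> _ := fun h => K_down v0 hB (range_up hi) h.
have Kj j : (0 < j <= n)%N -> _ := fun h => K_down v0 hB (range_up hj) h.
rewrite mulmxA (weight_mul3 (s := -1) _ _ (Ki _ hi) (Ki _ hj) (Ki _ hj)); last first.
  by move: i0 hi'; weight_calc.
rewrite (weight_mul3 (s := -1 + 2) _ _ (Kj _ hi) (Kj _ hi) (Ki _ hi)); last first.
  by move: i0 hi'; weight_calc.
rewrite (weight_mul3 (s := -1 + 1) _ _ (Ki _ hj) (Ki _ hi) (Kj _ hi)); last first.
  by move: i0 hi'; weight_calc.
rewrite (K_op3r _ i.+1) (K_op3 i.+1) (K_op3r _ i.+1) addrC.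
(* Transposition turns [E] into [Ft] and reverses products, so the coefficient [q] now sits on the
   other outer term; hence the preceding [addrC]. *)
apply: serre_rescale; have := congr1 trmx (up_serre_next K hB i0 hi').
by rewrite linearD !linearZ /= !trmx_mul -!rel_op_down !mulmxA.
Qed.

Lemma f_serre_prev j : (0 < j)%N -> (j < n)%N ->
  f j.+1 *m f j.+1 *m f j + f j *m (f j.+1 *m f j.+1) = (v + v^-1) *: (f j.+1 *m f j *m f j.+1).
Proof.
move=> j0 hj'; have hj : (0 < j <= n)%N by rewrite j0 ltnW.
have hi : (0 < j.+1 <= n)%N by [].
have Kj l : (0 < l <= n)%N -> _ := fun h => K_down v0 hB (range_up hj) h.
have Ki l : (0 < l <= n)%N -> _ := fun h => K_down v0 hB (range_up hi) h.
rewrite mulmxA (weight_mul3 (s := -1 + 2) _ _ (Ki _ hi) (Ki _ hj) (Ki _ hj)); last first.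
  by move: j0 hj'; weight_calc.
rewrite (weight_mul3 (s := -1) _ _ (Kj _ hi) (Kj _ hi) (Ki _ hi)); last first.
  by move: j0 hj'; weight_calc.
rewrite (weight_mul3 (s := -1 + 1) _ _ (Ki _ hj) (Ki _ hi) (Kj _ hi)); last first.
  by move: j0 hj'; weight_calc.
rewrite (K_op3r _ j) (K_op3 j) (K_op3r _ j).
apply: serre_rescale; have := congr1 trmx (up_serre_prev K hB j0 hj').
by rewrite addrC linearD !linearZ /= !trmx_mul -!rel_op_down !mulmxA.
Qed.

Definition t_op := v *: (k n *m ki n.+1) + v^-1 *: (ki n *m k n.+1).

Lemma e_last : (0 < n)%N ->
  e n *m e n *m f n + f n *m (e n *m e n) = (v + v^-1) *: (e n *m f n *m e n - e n *m t_op).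
Proof.
move=> n0; have hn : (0 < n <= n)%N by rewrite n0 leqnn.
have Kn1u := K_up v0 hB (a := n.+1) (leqnn _) hn.
have Kn1d := K_down v0 hB (a := n.+1) (leqnn _) hn.
have Knu := K_up v0 hB (range_up hn) hn.
have Knd := K_down v0 hB (range_up hn) hn.
rewrite mulmxA (weight_mul3 (s := 0 + 2) _ _ Kn1u Kn1d Kn1d); last first.
  by move: n0; weight_calc.
rewrite (weight_mul3 (s := 0) _ _ Knu Knu Kn1u); last first.
  by move: n0; weight_calc.
rewrite (weight_mul3 (s := 0 + 1) _ _ Kn1d Kn1u Knu); last first.
  by move: n0; weight_calc.
rewrite (K_op3r _ n) (K_op3 n) (K_op3r _ n).
have h := up_down_last v2 hB hF n0; rewrite (mulmxA (Ft n)) in h.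
rewrite (serre_rescale 0 _ h); congr (_ *: _); rewrite mulmxBl scalerBr; congr (_ - _).
(* The collected diagonal contains [k n.+1] twice and [k n] once. One [k n.+1] belongs to [e n]; the
   rest, with the factor [v], turns the two powers in [up_down_last] into those of [t_op]. *)
rewrite /e_op -!(mulmxA (E n)) scalemxAr; congr (_ *m _).
rewrite /t_op mulmxDr -!scalemxAr !diag_opM /diag_op !kmxZ kmxD.
apply: eq_kmx => V W; case: eqP => _; rewrite ?mulr0 ?addr0 //.
rewrite mulrDl mulrDr -exprN1 -!v_unit_expD v_mul_exp.
congr (_ ^ _ + _ ^ _); dimlia.
Qed.

Lemma rel_op_up j : (Ft j)^T = E j.
Proof. by rewrite rel_op_down trmxK. Qed.

Lemma diag_op_tr (w : flag -> K) : (diag_op w)^T = diag_op w.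
Proof. by apply/matrixP => x y; rewrite !mxE eq_sym; case: eqP => // ->. Qed.

Lemma t_opE : t_op = diag_op (fun V =>
  v ^ (1 - (gap V n)%:Z + (gap V n.+1)%:Z) + v ^ ((gap V n)%:Z - (gap V n.+1)%:Z - 1)).
Proof.
rewrite /t_op !diag_opM /diag_op !kmxZ kmxD; apply: eq_kmx => V W.
case: eqP => _; rewrite ?mulr0 ?addr0 // -exprN1 -!v_unit_expD v_mul_exp.
by congr (_ ^ _ + _ ^ _); dimlia.
Qed.

Lemma f_last : (0 < n)%N ->
  f n *m f n *m e n + e n *m (f n *m f n) = (v + v^-1) *: (f n *m e n *m f n - t_op *m f n).
Proof.
move=> n0; have hn : (0 < n <= n)%N by rewrite n0 leqnn.
have Kn1u := K_up v0 hB (a := n.+1) (leqnn _) hn.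
have Kn1d := K_down v0 hB (a := n.+1) (leqnn _) hn.
have Knu := K_up v0 hB (range_up hn) hn.
have Knd := K_down v0 hB (range_up hn) hn.
rewrite mulmxA (weight_mul3 (s := 1) _ _ Knd Knu Knu); last first.
  by move: n0; weight_calc.
rewrite (weight_mul3 (s := 1 + 2) _ _ Kn1d Kn1d Knd); last first.
  by move: n0; weight_calc.
rewrite (weight_mul3 (s := 1 + 1) _ _ Knu Knd Kn1d); last first.
  by move: n0; weight_calc.
rewrite (K_op3r n n.+1) (K_op3r n n n.+1) (K_op3 n.+1) addrC.
have h := congr1 trmx (up_down_last v2 hB hF n0).
rewrite linearD !linearZ linearB /= !trmx_mul !rel_op_up diag_op_tr -!rel_op_down in h.
rewrite !mulmxA in h.
rewrite (serre_rescale 1 _ h); congr (_ *: _); rewrite mulmxBl scalerBr; congr (_ - _).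
rewrite t_opE /f_op mulmxA !diag_opM !diag_opMl !diag_opMr kmxZ; apply: eq_kmx => V W.
case: (boolP (down n V W)) => VW; rewrite ?mulr0 ?mul0r ?mulr0 // !mulr1.
(* Here [t_op] acts from the left and sees the gaps of [V], whereas the collected diagonal sees
   those of [W]; [gap_up] compares them. *)
rewrite downE in VW; rewrite (gap_up hB (range_up hn) hn VW).
rewrite (gap_up hB (a := n.+1) (leqnn _) hn VW) !weightE !eqxx (gtn_eqF (ltnSn n)).
rewrite mulrCA !mulrDl -!v_unit_expD.
congr (_ ^ _ + _ ^ _); dimlia.
Qed.

End OperatorRelations.

(** * Evaluation of Laurent polynomials *)

Section LaurentEval.
Variables (K : fieldType) (v : K).
Hypothesis v0 : v != 0.

Lemma laurent_repr (x : Laurent) :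
  {kp : nat * {poly int} | \val x * vQ ^+ kp.1 = tofrac kp.2}.
Proof.
by apply: cid; have /laurentP[k [p E]] := valP x; exists (k, p).
Qed.

Definition int_eval (p : {poly int}) : K := (map_poly intr p).[v].

Definition laurent_eval (x : Laurent) : K :=
  let: (k, p) := sval (laurent_repr x) in int_eval p / v ^+ k.

(** The value does not depend on the representation chosen: two numerators agree after
    multiplication by suitable powers of ['X], and [v] is nonzero. *)
Lemma laurent_evalE (x : Laurent) k (p : {poly int}) :
  \val x * vQ ^+ k = tofrac p -> laurent_eval x = int_eval p / v ^+ k.
Proof.
rewrite /laurent_eval; case: (laurent_repr x) => [[l r] /= hr] hp.
have : r * 'X^k = p * 'X^l.
  apply/eqP; rewrite -tofrac_eq; rewrite !tofracM !tofracXn -hr -hp -/vQ.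
  by rewrite -!mulrA [vQ ^+ k * _]mulrC.
move=> /(congr1 (fun s => int_eval s)); rewrite /int_eval !rmorphM /= !map_polyXn !hornerM !hornerXn.
move=> E; apply/eqP; rewrite eqr_div ?expf_neq0 //.
by rewrite E.
Qed.

Lemma laurent_eval_is_additive : zmod_morphism laurent_eval.
Proof.
move=> x y; have [[k p] /= hp] := laurent_repr x; have [[l r] /= hr] := laurent_repr y.
rewrite (laurent_evalE hp) (laurent_evalE hr).
rewrite (@laurent_evalE _ (k + l)%N (p * 'X^l - r * 'X^k)); last first.
  rewrite tofracB !tofracM !tofracXn -hp -hr -/vQ exprD /= mulrBl !mulrA.
  by congr (_ - _); rewrite -!mulrA [vQ ^+ k * _]mulrC.
rewrite /int_eval rmorphB !rmorphM /= !map_polyXn hornerD hornerN !hornerM !hornerXn exprD.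
have vk : v ^+ k != 0 by rewrite expf_neq0.
have vl : v ^+ l != 0 by rewrite expf_neq0.
move: (v ^+ k) (v ^+ l) vk vl => a b a0 b0; field.
by rewrite a0 b0.
Qed.
HB.instance Definition _ :=
  GRing.isZmodMorphism.Build Laurent K laurent_eval laurent_eval_is_additive.

Lemma laurent_eval_is_multiplicative : monoid_morphism laurent_eval.
Proof.
split=> [|x y].
  rewrite (@laurent_evalE _ 0 1) ?expr0 ?mulr1 ?tofrac1 //.
  by rewrite /int_eval rmorph1 hornerC divr1.
have [[k p] /= hp] := laurent_repr x; have [[l r] /= hr] := laurent_repr y.
rewrite (laurent_evalE hp) (laurent_evalE hr) (@laurent_evalE _ (k + l)%N (p * r)); last first.
  by rewrite tofracM -hp -hr exprD /= mulrACA.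
by rewrite /int_eval rmorphM hornerM exprD invfM mulrACA.
Qed.
HB.instance Definition _ :=
  GRing.isMonoidMorphism.Build Laurent K laurent_eval laurent_eval_is_multiplicative.

Lemma laurent_eval_vpow z : laurent_eval (vpow z) = v ^ z.
Proof.
case: z => m.
  rewrite (@laurent_evalE _ 0 'X^m); last by rewrite expr0 mulr1 tofracXn.
  by rewrite /int_eval map_polyXn hornerXn divr1.
rewrite (@laurent_evalE _ m.+1 1) /int_eval ?rmorph1 ?hornerC ?div1r //.
by rewrite /= NegzE -exprnN mulVf ?expf_neq0 ?vQ_neq0 // tofrac1.
Qed.

Lemma laurent_eval_at_v2 p m : v ^+ 2 = m%:R -> laurent_eval (at_v2 p) = p.[m%:R]%:~R.
Proof.
move=> v2; rewrite (@laurent_evalE _ 0 (p \Po 'X^2)) ?expr0 ?mulr1 // divr1.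
rewrite /int_eval map_comp_poly map_polyXn horner_comp hornerXn v2.
by rewrite -(rmorph_nat (intr : int -> K)) horner_map.
Qed.

Lemma laurent_eval_root x k (p : {poly int}) :
  \val x * vQ ^+ k = tofrac p -> laurent_eval x = 0 -> root (map_poly intr p : {poly K}) v.
Proof.
move=> hp; rewrite (laurent_evalE hp) => /eqP.
by rewrite mulf_eq0 invr_eq0 (negbTE (expf_neq0 _ v0)) orbF.
Qed.
End LaurentEval.

Lemma odd_primes (m : nat) :
  exists s : seq nat, [/\ size s = m, uniq s & all (fun p => prime p && odd p) s].
Proof.
elim: m => [|m [s [sz us hs]]]; first by exists [::].
(* The bound exceeds every element of [s], so [p] is new, and exceeds 2, so [p] is odd. *)
have [p ps pr_p] := prime_above (sumn s).+2.
exists (p :: s); rewrite /= sz us hs pr_p !andbT; split=> //; last first.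
  by case: (even_prime pr_p) ps => [-> //|->].
apply/negP => /(nthP 0%N)[i is_ pE].
have : (p <= sumn s)%N by rewrite -pE sumnE (big_nth 0%N) (bigD1_seq i) ?mem_index_iota ?iota_uniq //= leq_addr.
by rewrite leqNgt (ltn_trans _ ps).
Qed.

(** A nonzero numerator [p] has fewer than [size p] roots, while [size p] distinct odd primes would
    all be roots. *)
Lemma laurent_eq0 (x : Laurent) :
  (forall p, prime p -> odd p -> laurent_eval (p%:R : rat) x = 0) -> x = 0.
Proof.
move=> H; have [[k p] /= hp] := laurent_repr x.
have [p0|p_neq0] := eqVneq p 0.
  apply: val_inj => /=; apply/eqP; move/eqP: hp; rewrite p0 tofrac0 mulf_eq0.
  by rewrite (negbTE (expf_neq0 _ vQ_neq0)) orbF.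
have [s [sz us hs]] := odd_primes (size p).
have intr_rat_inj : injective (intr : int -> rat) by apply: intr_inj.
have mp_size : size (map_poly (intr : int -> rat) p) = size p.
  by rewrite size_map_inj_poly.
have mp_neq0 : map_poly (intr : int -> rat) p != 0.
  by rewrite -size_poly_eq0 mp_size size_poly_eq0.
suff : (size p < size p)%N by rewrite ltnn.
rewrite -{1}sz -(size_map (fun i => i%:R : rat)) -mp_size; apply: max_poly_roots => //.
  apply/allP => _ /mapP[i /(allP hs)/andP[pr_i odd_i] ->].
  apply: (laurent_eval_root _ hp); first by rewrite pnatr_eq0 -lt0n prime_gt0.
  exact: H.
by rewrite map_inj_uniq // => i j /eqP; rewrite eqr_nat => /eqP.
Qed.

Lemma qint2E : qint 2 = vpow 1 + vpow (-1).
Proof.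
apply: val_inj; rewrite /= -exprnP exprN1.
have v2_neq1 : vQ - vQ^-1 != 0.
  rewrite subr_eq0; apply/eqP => /(congr1 ( *%R^~ vQ)); rewrite mulVf ?vQ_neq0 //.
  rewrite -expr2 /vQ -tofracXn -tofrac1 => /eqP; rewrite tofrac_eq => /eqP/(congr1 (fun p : {poly int} => size p)).
  by rewrite size_polyXn size_poly1.
by apply: (mulIf v2_neq1); rewrite divfK // [RHS]mulrC -subr_sqr exprVn -exprnN.
Qed.

(** * Relative positions *)

(** For [A = relpos V W] this recovers [\dim (V_k :&: W_l)], from which dimensions and inclusions
    can be read off. *)
Definition corner_sum N (A : 'M[nat]_N) (k l : nat) : nat :=
  (\sum_(i < N | (i < k)%N) \sum_(j < N | (j < l)%N) A i j)%N.

Lemma sum_ord_ltS N (f : 'I_N -> nat) k (kN : (k < N)%N) :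
  (\sum_(i < N | i < k.+1) f i = \sum_(i < N | i < k) f i + f (Ordinal kN))%N.
Proof.
rewrite (bigD1 (Ordinal kN)) //= addnC; congr (_ + _)%N.
by apply: eq_bigl => i; rewrite ltnS -val_eqE /= andbC -ltn_neqAle.
Qed.

Section RelativePosition.
Variables (n d : nat) (F : finFieldType).
Local Notation U := 'rV[F]_(Ndim d).
Variable B : {symmetric U}.
Local Notation "S ^!" := (orthov B S).
Local Notation flag := (flag n B).
Local Notation N := (Ndim n).
Implicit Types (V W : flag).

Definition cap_dim V W k l : nat := \dim (Vpart V k :&: Vpart W l).

(** The entry is the mixed second difference of [cap_dim]; it is stated additively because
    subtraction on [nat] truncates. *)
Lemma relpos_cap_dim V W (i j : 'I_N) :
  (relpos V W i j + cap_dim V W i j.+1 + cap_dim V W i.+1 j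
   = cap_dim V W i.+1 j.+1 + cap_dim V W i j)%N.
Proof.
rewrite mxE /cap_dim.
have subV : (Vpart V i <= Vpart V i.+1)%VS by apply: Vpart_sub.
have subW : (Vpart W j <= Vpart W j.+1)%VS by apply: Vpart_sub.
have dim_layer l : \dim (Vpart V i + Vpart V i.+1 :&: Vpart W l) =
    (\dim (Vpart V i) + \dim (Vpart V i.+1 :&: Vpart W l) - \dim (Vpart V i :&: Vpart W l))%N.
  have := dimv_sum_cap (Vpart V i) (Vpart V i.+1 :&: Vpart W l).
  by rewrite capvA (capv_idPl subV); dimlia.
have le_layer l : (\dim (Vpart V i :&: Vpart W l) <= \dim (Vpart V i.+1 :&: Vpart W l))%N.
  by rewrite dimvS // capvS.
have := dimv_sum_cap (Vpart V i) (Vpart V i.+1 :&: Vpart W j.+1).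
have := dimv_sum_cap (Vpart V i) (Vpart V i.+1 :&: Vpart W j).
rewrite !capvA (capv_idPl subV).
have : (\dim (Vpart V i + Vpart V i.+1 :&: Vpart W j)
        <= \dim (Vpart V i + Vpart V i.+1 :&: Vpart W j.+1))%N.
  by rewrite dimvS // addvS // capvS.
by dimlia.
Qed.

Lemma cap_dim0l V W l : cap_dim V W 0 l = 0%N.
Proof. by rewrite /cap_dim Vpart0 cap0v dimv0. Qed.

Lemma cap_dim0r V W k : cap_dim V W k 0 = 0%N.
Proof. by rewrite /cap_dim Vpart0 capv0 dimv0. Qed.

Lemma cap_dimC V W k l : cap_dim V W k l = cap_dim W V l k.
Proof. by rewrite /cap_dim capvC. Qed.

Lemma cap_dim_fullr V W k : cap_dim V W k N = \dim (Vpart V k).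
Proof. by rewrite /cap_dim Vpart_full capvf. Qed.

Lemma corner_sum_relpos V W k l : (k <= N)%N -> (l <= N)%N ->
  corner_sum (relpos V W) k l = cap_dim V W k l.
Proof.
move=> kN lN.
have row (i : 'I_N) : (\sum_(j < N | j < l) relpos V W i j + cap_dim V W i l
                       = cap_dim V W i.+1 l)%N.
  elim: l lN => [_|l IH lN]; first by rewrite !cap_dim0r big_pred0.
  rewrite (sum_ord_ltS _ lN); have := IH (ltnW lN); have /= := relpos_cap_dim V W i (Ordinal lN).
  by dimlia.
rewrite /corner_sum; elim: k kN => [_|k IH kN]; first by rewrite cap_dim0l big_pred0.
by rewrite (sum_ord_ltS _ kN) IH ?(ltnW kN) // addnC; exact: (row (Ordinal kN)).
Qed.

Hypothesis hB : nondegenerate B.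

(** The intersection of [V_(N-k)] and [W_(N-l)] is the orthogonal of [V_k + W_l]. This is the source
    of the central symmetry of [relpos V W]. *)
Lemma cap_dim_orthov V W k l : (k <= N)%N -> (l <= N)%N ->
  (cap_dim V W (N - k) (N - l) + \dim (Vpart V k) + \dim (Vpart W l)
   = Ndim d + cap_dim V W k l)%N.
Proof.
move=> kN lN; rewrite /cap_dim.
rewrite (Vpart_orthov V (leq_subr k N)) (Vpart_orthov W (leq_subr l N)) !subKn //.
rewrite -orthovDI dim_orthov //.
have := dimv_sum_cap (Vpart V k) (Vpart W l); have := dimv_le (Vpart V k + Vpart W l)%VS.
by dimlia.
Qed.

Lemma relpos_is_Xi V W : is_Xi d (relpos V W).
Proof.
apply/andP; split.
  have := corner_sum_relpos V W (leqnn N) (leqnn N).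
  rewrite cap_dim_fullr Vpart_full dimvf /dim /= mul1n /corner_sum => <-; apply/eqP.
  by apply: eq_big => [i|i _]; rewrite ?ltn_ord //; apply: eq_bigl => j; rewrite ltn_ord.
apply/forallP => i; apply/forallP => j; apply/eqP.
have /= := relpos_cap_dim V W i j; have /= := relpos_cap_dim V W (rev_ord i) (rev_ord j).
rewrite !subnSK //.
have iN := ltn_ord i; have jN := ltn_ord j.
have := cap_dim_orthov V W iN jN; have := cap_dim_orthov V W (ltnW iN) jN.
have := cap_dim_orthov V W iN (ltnW jN); have := cap_dim_orthov V W (ltnW iN) (ltnW jN).
by dimlia.
Qed.

Definition Xi_of V W : Xi n d := MkXi (relpos_is_Xi V W).

Lemma in_Orb V W (A : Xi n d) : ((V, W) \in Orb B A) = (Xi_of V W == A).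
Proof. by rewrite inE. Qed.

End RelativePosition.

(** Only dimensions matter because [V_k :&: V_l] is [V_(minn k l)]. The two forms may differ, which
    allows orbits for [B] and [B'] to be compared. *)
Lemma relpos_diag n d (F : finFieldType) (B B' : {symmetric 'rV[F]_(Ndim d)})
    (V : flag n B) (W : flag n B') :
    (forall k, (k <= Ndim n)%N -> \dim (Vpart V k) = \dim (Vpart W k)) ->
  relpos V V = relpos W W.
Proof.
move=> eq_dim; apply/matrixP => i j.
have cap_diag (B1 : {symmetric 'rV[F]_(Ndim d)}) (X : flag n B1) k l :
    (k <= Ndim n)%N -> (l <= Ndim n)%N -> cap_dim X X k l = \dim (Vpart X (minn k l)).
  move=> kN lN; rewrite /cap_dim; case: (leqP k l) => kl.
    by rewrite (capv_idPl (Vpart_sub X kl lN)).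
  by rewrite (capv_idPr (Vpart_sub X (ltnW kl) kN)).
have := relpos_cap_dim V V i j; have := relpos_cap_dim W W i j.
rewrite !cap_diag ?(ltnW (ltn_ord _)) // !eq_dim ?geq_min ?ltn_ord ?(ltnW (ltn_ord _)) //.
by dimlia.
Qed.

(** * The split form *)

Section XiLabelling.
Variables (n d : nat) (A : Xi n d).
Local Notation N := (Ndim n).
Local Notation D := (Ndim d).
Local Notation a := (Xi_mx A).

Lemma rev_allpairs (S T R : Type) (f : S -> T -> R) (s : seq S) (t : seq T) :
  rev [seq f x y | x <- s, y <- t] = [seq f x y | x <- rev s, y <- rev t].
Proof.
rewrite rev_flatten -!map_comp -map_rev; congr flatten.
by apply: eq_map => x /=; rewrite map_rev.
Qed.

Lemma rev_enum_ord m : rev (enum 'I_m) = map (@rev_ord m) (enum 'I_m).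
Proof.
case: m => [|m]; first by rewrite (size0nil (size_enum_ord 0)).
have sz := size_enum_ord m.+1.
apply: (@eq_from_nth _ ord0) => [|i]; rewrite size_rev; first by rewrite size_map.
rewrite sz => im.
rewrite nth_rev ?sz // (nth_map ord0) ?sz //.
by apply: val_inj; rewrite /= !nth_enum_ord // subSS ltnS leq_subr.
Qed.

Definition Xi_seq : seq ('I_N * 'I_N) :=
  flatten [seq nseq (a i j) (i, j) | i <- enum 'I_N, j <- enum 'I_N].

Lemma count_Xi_seq (P : pred ('I_N * 'I_N)) :
  count P Xi_seq = (\sum_i \sum_j P (i, j) * a i j)%N.
Proof.
rewrite /Xi_seq count_flatten map_allpairs sumnE big_allpairs_dep big_enum /=.
apply: eq_bigr => i _; rewrite big_enum /=; apply: eq_bigr => j _.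
by rewrite count_nseq.
Qed.

Lemma size_Xi_seq : size Xi_seq = D.
Proof.
rewrite -count_predT count_Xi_seq; have /andP[/eqP <- _] := valP A.
by apply: eq_bigr => i _; apply: eq_bigr => j _; rewrite mul1n.
Qed.

Definition rev_pair (p : 'I_N * 'I_N) := (rev_ord p.1, rev_ord p.2).

(** Reversing the lexicographic list of cells reverses both indices, and the symmetry of [A]
    preserves the multiplicities. *)
Lemma rev_Xi_seq : rev Xi_seq = map rev_pair Xi_seq.
Proof.
have /andP[_ /forallP sym] := valP A.
rewrite /Xi_seq rev_flatten map_allpairs rev_allpairs !rev_enum_ord.
rewrite allpairs_mapl allpairs_mapr map_flatten map_allpairs; congr flatten.
apply: eq_allpairs => i j /=.
by rewrite rev_nseq map_nseq -(eqP (forallP (sym i) j)).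
Qed.

(* Labels of the coordinates of F^D: the flags spanned by the coordinates with
   small first, respectively second, label are in relative position A. *)
Lemma label_exists : exists c : 'I_D -> 'I_N * 'I_N,
  (forall x, c (rev_ord x) = rev_pair (c x)) /\
  (forall i j, #|[pred x | c x == (i, j)]| = a i j).
Proof.
pose p0 : 'I_N * 'I_N := (ord0, ord0).
exists (fun x => nth p0 Xi_seq x); split=> [x | i j].
  have xs : (x < size Xi_seq)%N by rewrite size_Xi_seq.
  by rewrite -(nth_map p0 p0) // -rev_Xi_seq nth_rev // size_Xi_seq.
rewrite cardE size_filter; have -> : a i j = count (pred1 (i, j)) Xi_seq.
  rewrite count_Xi_seq (bigD1 i) //= (bigD1 j) //= eqxx mul1n !big1 ?addn0 // => [i' ni|j' nj].
    by apply: big1 => j' _; rewrite xpair_eqE (negbTE ni).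
  by rewrite xpair_eqE (negbTE nj) andbF.
rewrite -[in RHS](mkseq_nth p0 Xi_seq) /mkseq size_Xi_seq -val_enum_ord -map_comp count_map enumT.
by apply: eq_count.
Qed.
End XiLabelling.

Section SplitForm.
Variables (F : finFieldType) (D : nat).
Local Notation U := 'rV[F]_D.
Implicit Types (u w : U) (P Q : pred 'I_D).

(** The antidiagonal form: orthogonals of coordinate subspaces are again coordinate subspaces, so
    labelled coordinates define flags. *)
Definition split_form u w : F := \sum_k u 0 k * w 0 (rev_ord k).

Lemma split_form_bilinear : bilinear_for
  (GRing.Scale.Law.clone _ _ ( *%R ) _) (GRing.Scale.Law.clone _ _ (idfun \; *%R ) _)
  split_form.
Proof.
split=> [w|u] a x y; rewrite /= /split_form mulr_sumr -big_split; apply: eq_bigr => k _ /=.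
  by rewrite !mxE mulrDl mulrA.
by rewrite !mxE mulrDr mulrCA.
Qed.
HB.instance Definition _ :=
  bilinear_isBilinear.Build F U U F (GRing.Scale.Law.clone _ _ ( *%R ) _)
    (GRing.Scale.Law.clone _ _ (idfun \; *%R ) _) split_form split_form_bilinear.

Lemma split_form_sym u w : split_form u w = (-1) ^+ false * idfun (split_form w u).
Proof.
rewrite expr0 mul1r /split_form (reindex_inj rev_ord_inj) /=.
by apply: eq_bigr => k _; rewrite rev_ordK mulrC.
Qed.
HB.instance Definition _ :=
  isHermitianSesquilinear.Build F U false idfun split_form split_form_sym.

Lemma split_form_delta u k : split_form u (delta_mx 0 k) = u 0 (rev_ord k).
Proof.
rewrite /split_form (bigD1 (rev_ord k)) //= mxE !rev_ordK !eqxx mulr1 big1 ?addr0 // => l nl.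
rewrite mxE eqxx /=; case: eqP => [E|_]; last by rewrite mulr0.
by rewrite -E rev_ordK eqxx in nl.
Qed.

Definition split_B : {symmetric U} := split_form.

Lemma split_nondegenerate : nondegenerate split_B.
Proof.
rewrite /nondegenerate -subv0; apply/subvP => u /mem_orthovP h.
rewrite memv0; apply/eqP/rowP => k; rewrite mxE -[k]rev_ordK -split_form_delta.
by apply: h; rewrite memvf.
Qed.

Definition unit_row (k : 'I_D) : U := delta_mx 0 k.

Definition coordv P : {vspace U} := <<[seq unit_row k | k <- enum P]>>%VS.

Lemma span_unit_row (s : seq 'I_D) u k :
  u \in <<map unit_row s>>%VS -> k \notin s -> u 0 k = 0.
Proof.
move=> us ks; pose f := linfun (mulmxr (delta_mx k 0 : 'cV[F]_D)) : 'Hom(U, 'rV[F]_1).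
have fE w : f w = (w 0 k)%:M.
  by rewrite lfunE /= -colE; apply/rowP => i; rewrite !mxE ord1 eqxx mulr1n.
have : (<<map unit_row s>> <= lker f)%VS.
  apply/span_subvP => _ /mapP[l ls ->]; rewrite memv_ker fE mxE eqxx /=.
  have -> : (k == l) = false by apply: contraNF ks => /eqP ->.
  by rewrite raddf0.
by move/subvP/(_ _ us); rewrite memv_ker fE => /eqP/rowP/(_ 0); rewrite !mxE eqxx mulr1n.
Qed.

Lemma mem_coordv P u : reflect (forall k, ~~ P k -> u 0 k = 0) (u \in coordv P).
Proof.
apply: (iffP idP) => [uP k nPk|h]; first by rewrite (span_unit_row uP) // mem_enum.
rewrite [u]row_sum_delta; apply: memv_suml => k _.
case: (boolP (P k)) => Pk; last by rewrite h // scale0r mem0v.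
by rewrite memvZ // memv_span // (map_f unit_row) // mem_enum.
Qed.

Lemma dim_coordv P : \dim (coordv P) = #|P|.
Proof.
rewrite cardE -(size_map unit_row); apply/eqP; rewrite -/(free _).
elim: (enum P) (enum_uniq P) => [|k s IH] /=; first by rewrite nil_free.
case/andP => ks us; rewrite free_cons IH // andbT.
apply/negP => /span_unit_row/(_ ks)/eqP.
by rewrite mxE !eqxx oner_eq0.
Qed.

Lemma coordvI P Q : (coordv P :&: coordv Q)%VS = coordv (predI P Q).
Proof.
apply/vspaceP => u; rewrite memv_cap; apply/andP/mem_coordv => [[/mem_coordv h /mem_coordv h'] k|h].
  by rewrite negb_and => /orP[/h|/h'].
by split; apply/mem_coordv => k nk; apply: h; rewrite /= negb_and nk ?orbT.
Qed.

Lemma eq_coordv P Q : P =1 Q -> coordv P = coordv Q.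
Proof. by move=> PQ; congr span; congr map; apply: eq_enum => k; apply: PQ. Qed.

Lemma coordv_sub P Q : (forall k, P k -> Q k) -> (coordv P <= coordv Q)%VS.
Proof.
move=> PQ; apply/subvP => u /mem_coordv h; apply/mem_coordv => k nQ; apply: h.
by apply: contra nQ; apply: PQ.
Qed.

Lemma orthov_coordv P :
  orthov split_B (coordv P) = coordv (fun k => ~~ P (rev_ord k)).
Proof.
apply/vspaceP => u; apply/mem_orthovP/mem_coordv => [h k|h w /mem_coordv hw].
  rewrite negbK => Pk; rewrite -[k]rev_ordK -split_form_delta; apply: h.
  by rewrite memv_span // (map_f unit_row) // mem_enum.
rewrite /= /split_form big1 // => k _.
case: (boolP (P (rev_ord k))) => Pk; first by rewrite h ?mul0r // negbK.
by rewrite hw // mulr0.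
Qed.

End SplitForm.

Section SplitOrbits.
Variables (n d : nat) (F : finFieldType).
Local Notation N := (Ndim n).
Local Notation D := (Ndim d).
Local Notation B := (split_B F D).

Lemma coordinate_flag (c : 'I_D -> 'I_N) : (forall x, c (rev_ord x) = rev_ord (c x)) ->
  {V : flag n B | forall k, (k <= N)%N -> Vpart V k = coordv F (fun x => (c x < k)%N)}.
Proof.
move=> crev.
pose f := [ffun k : 'I_N.+1 => coordv F (fun x => (c x < k)%N)].
have hf : is_flag B f.
  apply/and4P; split.
  - by rewrite ffunE -dimv_eq0 dim_coordv eq_card0.
  - rewrite ffunE eqEsubv subvf /=; apply/subvP => u _; apply/mem_coordv => k.
    by rewrite ltn_ord.
  - apply/forallP => k; apply/forallP => l; apply/implyP => kl; rewrite !ffunE.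
    by apply: coordv_sub => x xk; apply: leq_trans kl.
  - apply/forallP => k; rewrite !ffunE orthov_coordv; apply/eqP; apply: eq_coordv => x.
    rewrite crev /=; have := ltn_ord (c x); have := ltn_ord k; dimlia.
exists (MkFlag hf) => k kN.
by rewrite /Vpart /= ffunE inordK.
Qed.

Lemma split_Orb_neq0 (A : Xi n d) : exists V W, (V, W) \in Orb B A.
Proof.
have [c [crev cA]] := label_exists A.
have [x|V hV] := @coordinate_flag (fun x => (c x).1); first by rewrite crev.
have [x|W hW] := @coordinate_flag (fun x => (c x).2); first by rewrite crev.
exists V, W; rewrite inE; apply/eqP/matrixP => i j; rewrite -cA.
have dimE k l : (k <= N)%N -> (l <= N)%N ->
    cap_dim V W k l = (\sum_x ((c x).1 < k)%N && ((c x).2 < l)%N)%N.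
  move=> kN lN; rewrite /cap_dim hV // hW // coordvI dim_coordv -sum1_card big_mkcond /=.
  by apply: eq_bigr => x _; rewrite unfold_in /=; case: (_ && _).
have := relpos_cap_dim V W i j; rewrite !dimE ?(ltnW (ltn_ord _)) // => h.
(* The same second difference as in [relpos_cap_dim], verified one coordinate [x] at a time. *)
have : (#|[pred x | c x == (i, j)]| + (\sum_x ((c x).1 < i)%N && ((c x).2 < j.+1)%N)
   + (\sum_x ((c x).1 < i.+1)%N && ((c x).2 < j)%N)
  = (\sum_x ((c x).1 < i.+1)%N && ((c x).2 < j.+1)%N)
   + (\sum_x ((c x).1 < i)%N && ((c x).2 < j)%N))%N.
  rewrite -sum1_card big_mkcond -!big_split /=; apply: eq_bigr => x _.
  rewrite inE; case: (c x) => k l /=; rewrite xpair_eqE -!val_eqE /=.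
  rewrite -[if _ then _ else _]/(nat_of_bool _).
  by move: (k : nat) (l : nat) (i : nat) (j : nat); dimlia.
by move: h => /=; dimlia.
Qed.
End SplitOrbits.

(** * Convolution of functions of the relative position *)

Section Coefficients.
Variables n d : nat.
Local Notation N := (Ndim n).
Implicit Type A : 'M[nat]_N.

(* For A = relpos V W these say V_k <= W_k, V_k >= W_k, and so on; the value of a
   generator at (V, W) is thus a function of A that does not involve the field. *)
Definition sub_mx A k := corner_sum A k k == corner_sum A k N.
Definition sup_mx A k := corner_sum A k k == corner_sum A N k.
Definition gap_mx A k := (corner_sum A N k - corner_sum A N k.-1)%N.
Definition agree_mx i A :=
  [forall j : 'I_n.+1, (0 < j)%N && (j != i :> nat) ==> sub_mx A j && sup_mx A j].

(** Coordinates in the basis [e_A]. This type does not mention the field, so that identities can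
    pass from one field to another. *)
Definition coef := {ffun Xi n d -> Laurent^o}.
HB.instance Definition _ := GRing.Lmodule.on coef.

Definition e_coef i : coef := [ffun X => let A := Xi_mx X in
  if sub_mx A i && (corner_sum A N i == (corner_sum A i N).+1) && agree_mx i A
  then vpow (- (gap_mx A i.+1)%:Z) else 0].
Definition f_coef i : coef := [ffun X => let A := Xi_mx X in
  if sup_mx A i && (corner_sum A i N == (corner_sum A N i).+1) && agree_mx i A
  then vpow (- (gap_mx A i)%:Z) else 0].
(** The index 0 excludes no place, so [agree_mx 0] expresses equality of the two flags. *)
Definition d_coef (s : int) a : coef := [ffun X => let A := Xi_mx X in
  if agree_mx 0 A then vpow (- s * (gap_mx A a)%:Z) else 0].
Definition one_coef : coef := [ffun X => (agree_mx 0 (Xi_mx X))%:R].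

Variables (F : finFieldType) (B : {symmetric 'rV[F]_(Ndim d)}).
Hypothesis hB : nondegenerate B.
Implicit Types V W : flag n B.
Local Notation Xi_of := (Xi_of hB).

Lemma corner_sum_left V W k : (k <= N)%N -> corner_sum (relpos V W) k N = \dim (Vpart V k).
Proof. by move=> kN; rewrite corner_sum_relpos // cap_dim_fullr. Qed.

Lemma corner_sum_right V W k : (k <= N)%N -> corner_sum (relpos V W) N k = \dim (Vpart W k).
Proof. by move=> kN; rewrite corner_sum_relpos // cap_dimC cap_dim_fullr. Qed.

Lemma sub_mxE V W k : (k <= N)%N -> sub_mx (relpos V W) k = (Vpart V k <= Vpart W k)%VS.
Proof.
move=> kN; rewrite /sub_mx corner_sum_left // corner_sum_relpos //.
rewrite /cap_dim (dimv_leqif_eq (capvSl _ _)); apply/eqP/idP => [<-|/capv_idPl //].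
exact: capvSr.
Qed.

Lemma sup_mxE V W k : (k <= N)%N -> sup_mx (relpos V W) k = (Vpart W k <= Vpart V k)%VS.
Proof.
move=> kN; rewrite /sup_mx corner_sum_right // corner_sum_relpos //.
rewrite /cap_dim (dimv_leqif_eq (capvSr _ _)); apply/eqP/idP => [<-|/capv_idPr //].
exact: capvSl.
Qed.

Lemma gap_mxE V W k : (k <= N)%N -> gap_mx (relpos V W) k = gap W k.
Proof.
by move=> kN; rewrite /gap_mx !corner_sum_right // (leq_trans (leq_pred _)).
Qed.

Lemma agree_mxE i V W : agree_mx i (relpos V W) = agree_off i V W.
Proof.
apply: eq_forallb => j; congr (_ ==> _); have := ltn_ord j => jn.
have jN : (j <= N)%N by move: jn; rewrite /Ndim; dimlia.
by rewrite sub_mxE // sup_mxE // eqEsubv.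
Qed.

Lemma eq_flag_agree V W : (V == W) = agree_off 0 V W.
Proof.
apply/eqP/agree_offP => [-> //|h]; apply: flag_ext => k /andP[k0 kn].
by apply: h => //; apply/eqP; rewrite -lt0n.
Qed.

Lemma e_coefE i V W : (0 < i <= n)%N -> e_fun n B i (V, W) = e_coef i (Xi_of V W).
Proof.
move=> /andP[i0 hi].
rewrite !ffunE /= /codim1 agree_mxE sub_mxE ?corner_sum_left ?corner_sum_right ?gap_mxE //;
  by rewrite /Ndim; move: hi; dimlia.
Qed.

Lemma f_coefE i V W : (0 < i <= n)%N -> f_fun n B i (V, W) = f_coef i (Xi_of V W).
Proof.
move=> /andP[i0 hi].
rewrite !ffunE /= /codim1 agree_mxE sup_mxE ?corner_sum_left ?corner_sum_right ?gap_mxE //;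
  by rewrite /Ndim; move: hi; dimlia.
Qed.

Lemma d_coefE s a V W : (0 < a <= n.+1)%N -> d_fun n B s a (V, W) = d_coef s a (Xi_of V W).
Proof.
move=> /andP[a0 ha]; rewrite !ffunE /= eq_flag_agree agree_mxE gap_mxE //.
by rewrite /Ndim; move: ha; dimlia.
Qed.

Lemma one_coefE V W : Defs.one_fun n B (V, W) = one_coef (Xi_of V W).
Proof. by rewrite !ffunE /= eq_flag_agree agree_mxE. Qed.

Definition of_coef (c : coef) : Sj n B := \sum_(A : Xi n d) c A *: charS B A.

Lemma of_coef_val c V W : Sj_val (of_coef c) (V, W) = c (Xi_of V W).
Proof.
have -> : Sj_val (of_coef c) = \sum_(A : Xi n d) c A *: char_fun B A.
  by rewrite /of_coef -[LHS]/(\val _) raddf_sum; apply: eq_bigr.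
rewrite sum_ffunE (bigD1 (Xi_of V W)) //= !ffunE (in_Orb hB) eqxx.
rewrite big1 => [|A neA]; first by rewrite addr0 /GRing.scale /= mulr1.
by rewrite !ffunE (in_Orb hB) eq_sym (negbTE neA) scaler0.
Qed.

Lemma of_coefP (s : Sj n B) (c : coef) : (forall V W, Sj_val s (V, W) = c (Xi_of V W)) -> s = of_coef c.
Proof.
by move=> h; apply: val_inj; apply/ffunP => -[V W]; rewrite /= h -of_coef_val.
Qed.

Lemma of_coef_is_linear : linear of_coef.
Proof.
move=> a c c'; apply/esym/of_coefP => V W.
rewrite -[LHS]/((\val (a *: of_coef c + of_coef c')) (V, W)) linearP /= !ffunE.
by rewrite -!of_coef_val.
Qed.
HB.instance Definition _ := GRing.isLinear.Build Laurent coef (Sj n B) _ of_coef of_coef_is_linear.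
End Coefficients.

(** * The product on coordinates and its specializations *)

Section Structure.
Variables (n d : nat) (g : Xi n d -> Xi n d -> Xi n d -> {poly int}).
Hypothesis hg : structure_polynomials g.
Local Notation coef := (coef n d).
Implicit Types (A : Xi n d) (c : coef).

Definition coef_conv c c' : coef := [ffun A'' =>
  \sum_(A : Xi n d) \sum_(A' : Xi n d) c A * c' A' * at_v2 (g A A' A'')].

Section FixedForm.
Variables (F : finFieldType) (hF : odd #|F|).
Variables (B : {symmetric 'rV[F]_(Ndim d)}) (hB : nondegenerate B).

Lemma trivial_flag : {V : flag n B |
  forall k, (k <= Ndim n)%N -> \dim (Vpart V k) = if (k <= n)%N then 0%N else Ndim d}.
Proof.
have [||| V hV] := @flag_exists n d F B hB (fun=> 0%VS) => //; first by rewrite sub0v.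
exists V => k kN; case: (leqP k n) => kn; first by rewrite hV // dimv0.
rewrite Vpart_orthov // hV; last by move: kN kn; rewrite /Ndim; dimlia.
by rewrite orthov0 dimvf /dim /= mul1n.
Qed.

(** Both forms yield the value of one polynomial at [#|F|]. The flag [V] makes it nonzero, so a
    middle flag exists for [B'] as well. *)
Lemma card_transfer (B' : {symmetric 'rV[F]_(Ndim d)}) (hB' : nondegenerate B')
    A A' A'' (V1 V2 V : flag n B) (W1 W2 : flag n B') :
    (V1, V2) \in Orb B A'' -> (W1, W2) \in Orb B' A'' ->
    (V1, V) \in Orb B A -> (V, V2) \in Orb B A' ->
  exists W, (W1, W) \in Orb B' A.
Proof.
move=> h12 h12' h1 h2.
have := hg hF hB A A' h12; rewrite (hg hF hB' A A' h12') => /eqP; rewrite eqr_nat => /eqP E.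
have : (0 < #|[set W | ((W1, W) \in Orb B' A) && ((W, W2) \in Orb B' A')]|)%N.
  by rewrite E; apply/card_gt0P; exists V; rewrite inE h1 h2.
by case/card_gt0P => W; rewrite inE => /andP[hW _]; exists W.
Qed.
End FixedForm.

(* The number of flags at given relative positions does not depend on the form,
   only on #|F|: an orbit of the split form is transported to B by first moving
   the trivial flag to a flag of the right type. *)
Lemma Orb_neq0 (F : finFieldType) (hF : odd #|F|)
    (B : {symmetric 'rV[F]_(Ndim d)}) (hB : nondegenerate B) A :
  exists p, p \in Orb B A.
Proof.
have hS := split_nondegenerate F (Ndim d).
have [V [W hVW]] := split_Orb_neq0 F A.
have [V0 dV0] := trivial_flag hS; have [W0 dW0] := trivial_flag hB.
have E0 : relpos W0 W0 = relpos V0 V0.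
  by apply: relpos_diag => k kN; rewrite dV0 // dW0.
have orbS (X Y : flag n (split_B F (Ndim d))) : (X, Y) \in Orb _ (Xi_of hS X Y) by rewrite inE.
(* Transfer of the closed path [V0], [V], [V0]; the flag [V'] obtained has the dimensions of [V]. *)
have [V' hV'] : exists V', (W0, V') \in Orb B (Xi_of hS V0 V).
  apply: (card_transfer hF hS hB (orbS V0 V0) _ (orbS V0 V) (orbS V V0) (W2 := W0)).
  by rewrite inE /= E0.
have E1 : relpos V' V' = relpos V V.
  apply: relpos_diag => k kN; move: hV'; rewrite inE /= => /eqP hV'.
  by rewrite -(corner_sum_right W0 V' kN) hV' corner_sum_right.
(* Transfer of the closed path [V], [W], [V], now started at [V']. *)
have [W' hW'] : exists W', (V', W') \in Orb B A.
  apply: (card_transfer hF hS hB (orbS V V) _ hVW (orbS W V) (W2 := V')).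
  by rewrite inE /= E1.
by exists (V', W').
Qed.

Section Convolution.
Variables (F : finFieldType) (hF : odd #|F|).
Variables (B : {symmetric 'rV[F]_(Ndim d)}) (hB : nondegenerate B).

(** Nonemptiness of the orbit is essential: on an empty one [coef_e] would return its default value
    0. *)
Lemma coef_e_of_coef c A : coef_e (of_coef B c) A = c A.
Proof.
rewrite /coef_e; case: pickP => [[V W]|no]; last first.
  by have [p hp] := Orb_neq0 hF hB A; rewrite no in hp.
by rewrite (in_Orb hB) (of_coef_val hB) => /eqP ->.
Qed.

Lemma conv_of_coef c c' : of_coef B c *[g] of_coef B c' = of_coef B (coef_conv c c').
Proof.
rewrite /conv; under eq_bigr do under eq_bigr do rewrite !coef_e_of_coef scaler_sumr.
under eq_bigr do rewrite exchange_big /=.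
rewrite exchange_big /= /of_coef; apply: eq_bigr => A'' _.
rewrite ffunE scaler_suml; apply: eq_bigr => A _.
by rewrite scaler_suml; apply: eq_bigr => A' _; rewrite scalerA.
Qed.
End Convolution.

Section Specialization.
Variables (F : finFieldType) (hF : odd #|F|).
Variables (B : {symmetric 'rV[F]_(Ndim d)}) (hB : nondegenerate B).
Variables (K : fieldType) (v : K) (v0 : v != 0) (v2 : v ^+ 2 = #|F|%:R).

Definition specialize c : 'M[K]_#|{: flag n B}| :=
  kmx (fun V W => laurent_eval v (c (Xi_of hB V W))).

(** Middle flags are grouped by their relative positions to both ends; each group has constant
    summand and its size is the structure polynomial at [q = v ^+ 2]. *)
Lemma specialize_conv c c' :
  specialize (coef_conv c c') = specialize c *m specialize c'.
Proof.
rewrite kmxM; apply: eq_kmx => V V'; rewrite ffunE rmorph_sum.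
rewrite (partition_big (fun W => Xi_of hB V W) xpredT) //=; apply: eq_bigr => A _.
rewrite rmorph_sum (partition_big (fun W => Xi_of hB W V') xpredT) //=.
apply: eq_bigr => A' _; rewrite !rmorphM /= (laurent_eval_at_v2 v0 _ v2).
have VV' : (V, V') \in Orb B (Xi_of hB V V') by rewrite inE.
rewrite (hg hF hB A A' VV') rmorph_nat.
rewrite (eq_bigr (fun=> laurent_eval v (c A) * laurent_eval v (c' A'))).
  rewrite sumr_const mulr_natr; congr (_ *+ _); apply: eq_card => W.
  by rewrite !inE.
by move=> W /andP[/eqP -> /eqP ->].
Qed.

Lemma specializeD c c' : specialize (c + c') = specialize c + specialize c'.
Proof. by rewrite kmxD; apply: eq_kmx => V W; rewrite ffunE rmorphD. Qed.

Lemma specializeZ (a : Laurent) c : specialize (a *: c) = laurent_eval v a *: specialize c.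
Proof. by rewrite kmxZ; apply: eq_kmx => V W; rewrite ffunE rmorphM. Qed.

Lemma specialize_e i : (0 < i <= n)%N -> specialize (e_coef n d i) = e_op n B v i.
Proof.
move=> hi; rewrite /e_op diag_opMr; apply: eq_kmx => V W.
rewrite -e_coefE // ffunE /= /up /step andbC.
by case: ifP => _; rewrite ?laurent_eval_vpow ?mul1r ?rmorph0 ?mul0r.
Qed.

Lemma specialize_f i : (0 < i <= n)%N -> specialize (f_coef n d i) = f_op n B v i.
Proof.
move=> hi; rewrite /f_op diag_opMr; apply: eq_kmx => V W.
rewrite -f_coefE // ffunE /= /down /step andbC.
by case: ifP => _; rewrite ?laurent_eval_vpow ?mul1r ?rmorph0 ?mul0r.
Qed.

Lemma specialize_d s a : (0 < a <= n.+1)%N ->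
  specialize (d_coef n d s a) = diag_op (fun V : flag n B => v ^ (- s * (gap V a)%:Z)).
Proof.
move=> ha; apply: eq_kmx => V W; rewrite -d_coefE // ffunE /=.
by case: ifP => _; rewrite ?laurent_eval_vpow ?rmorph0.
Qed.

Lemma specialize_one : specialize (one_coef n d) = 1%:M.
Proof.
rewrite -(@diag_op1 n d F B K (fun=> 1)) //; apply: eq_kmx => V W.
by rewrite -one_coefE ffunE /=; case: eqP; rewrite ?rmorph1 ?rmorph0.
Qed.
End Specialization.

(** Over a field with [p ^ 2] elements and the split form, every [A] occurs as a relative position,
    so each coordinate is an entry of the specialized matrix at [v = p]. Then [laurent_eq0] applies
    to the difference. *)
Lemma specialize_faithful c c' :
  (forall (F : finFieldType) (hF : odd #|F|) (B : {symmetric 'rV[F]_(Ndim d)})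
     (hB : nondegenerate B) (v : rat), v != 0 -> v ^+ 2 = #|F|%:R ->
     specialize hB v c = specialize hB v c') ->
  c = c'.
Proof.
move=> h; apply/ffunP => A; apply/eqP; rewrite -subr_eq0; apply/eqP.
apply: laurent_eq0 => p pr_p odd_p.
have [F _ cardF] := pPrimePowerField pr_p (ltn0Sn 1).
have p0 : (p%:R : rat) != 0 by rewrite pnatr_eq0 -lt0n prime_gt0.
have hF : odd #|F| by rewrite cardF oddX odd_p.
have hB := split_nondegenerate F (Ndim d).
have [[V W]] := Orb_neq0 hF hB A; rewrite (in_Orb hB) => /eqP <-.
have v2 : (p%:R : rat) ^+ 2 = #|F|%:R by rewrite cardF natrX.
have := kmx_inj (h F hF _ hB _ p0 v2) V W.
by rewrite rmorphB /= => ->; rewrite subrr.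
Qed.
End Structure.

(** * The relations *)

Section Generators.
Variables (n d : nat) (F : finFieldType).
Variables (B : {symmetric 'rV[F]_(Ndim d)}) (hB : nondegenerate B).

Lemma eS_of_coef i : (0 < i <= n)%N -> eS n B i = of_coef B (e_coef n d i).
Proof. by move=> hi; apply: (of_coefP (hB := hB)) => V W; rewrite -e_coefE. Qed.

Lemma fS_of_coef i : (0 < i <= n)%N -> fS n B i = of_coef B (f_coef n d i).
Proof. by move=> hi; apply: (of_coefP (hB := hB)) => V W; rewrite -f_coefE. Qed.

Lemma dS_of_coef a : (0 < a <= n.+1)%N -> dS n B a = of_coef B (d_coef n d 1 a).
Proof. by move=> ha; apply: (of_coefP (hB := hB)) => V W; rewrite -d_coefE. Qed.

Lemma dinvS_of_coef a : (0 < a <= n.+1)%N -> dinvS n B a = of_coef B (d_coef n d (-1) a).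
Proof. by move=> ha; apply: (of_coefP (hB := hB)) => V W; rewrite -d_coefE. Qed.

Lemma oneS_of_coef : oneS n B = of_coef B (one_coef n d).
Proof. by apply: (of_coefP (hB := hB)) => V W; rewrite -one_coefE. Qed.

Lemma of_coefD (c c' : coef n d) : of_coef B c + of_coef B c' = of_coef B (c + c').
Proof. exact/esym/(linearD (of_coef B)). Qed.

Lemma of_coefB (c c' : coef n d) : of_coef B c - of_coef B c' = of_coef B (c - c').
Proof. exact/esym/(linearB (of_coef B)). Qed.

Lemma of_coefZ (a : Laurent) (c : coef n d) : a *: of_coef B c = of_coef B (a *: c).
Proof. by rewrite linearZ. Qed.

Variables (K : fieldType) (v : K) (v0 : v != 0).

Lemma laurent_eval_nat m : laurent_eval v m%:R = m%:R.
Proof. exact: rmorph_nat. Qed.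

Lemma laurent_eval_qint2 : laurent_eval v (qint 2) = v + v^-1.
Proof. by rewrite qint2E rmorphD /= !laurent_eval_vpow // expr1z exprN1. Qed.

Lemma laurent_eval_v_subV : laurent_eval v (vpow 1 - vpow (-1)) = v - v^-1.
Proof. by rewrite rmorphB /= !laurent_eval_vpow // expr1z exprN1. Qed.

Lemma specializeB (c c' : coef n d) :
  specialize hB v (c - c') = specialize hB v c - specialize hB v c'.
Proof.
by apply/matrixP => x y; rewrite !mxE !ffunE rmorphB.
Qed.

Lemma specialize_dS a : (0 < a <= n.+1)%N -> specialize hB v (d_coef n d 1 a) = K_op n B v a.
Proof.
by move=> ha; rewrite (specialize_d _ v0) //; apply: eq_kmx => V W; rewrite mulN1r.
Qed.

Lemma specialize_dinvS a : (0 < a <= n.+1)%N ->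
  specialize hB v (d_coef n d (-1) a) = Kinv_op n B v a.
Proof.
by move=> ha; rewrite (specialize_d _ v0) //; apply: eq_kmx => V W; rewrite opprK mul1r.
Qed.
End Generators.

Theorem proposition3p1 (n d : nat) (hn : (1 <= n)%N) (hd : (1 <= d)%N)
    (g : Xi n d -> Xi n d -> Xi n d -> {poly int})
    (hg : structure_polynomials g)
    (F : finFieldType) (hF : odd #|F|)
    (B : {symmetric 'rV[F]_(Ndim d)}) (hB : nondegenerate B) :
  let e : nat -> Sj n B := @eS n d F B in
  let f : nat -> Sj n B := @fS n d F B in
  let dp : nat -> Sj n B := @dS n d F B in
  let dm : nat -> Sj n B := @dinvS n d F B in
  let one : Sj n B := oneS n B in
  let v : Laurent := vpow 1 in
  let vi : Laurent := vpow (-1) in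
  let t : Sj n B := v *: (dp n *[g] dm n.+1) + vi *: (dm n *[g] dp n.+1) in
  forall i j : nat, (1 <= i <= n)%N -> (1 <= j <= n)%N ->
  (dp i *[g] dm i = one /\ dm i *[g] dp i = one) /\
  dp i *[g] dp j = dp j *[g] dp i /\
  dp i *[g] e j *[g] dm i = vpow ((i == j)%:Z - (i == j.+1)%:Z) *: e j /\
  dp i *[g] f j *[g] dm i = vpow (- (i == j)%:Z + (i == j.+1)%:Z) *: f j /\
  (i <> n -> j <> n ->
     (v - vi) *: (e i *[g] f j - f j *[g] e i)
     = (i == j)%:R *: (dp i *[g] dm i.+1 - dm i *[g] dp i.+1)) /\
  (`|i%:Z - j%:Z| = 1 ->
     e i *[g] e i *[g] e j + e j *[g] (e i *[g] e i)
       = qint 2 *: (e i *[g] e j *[g] e i) /\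
     f i *[g] f i *[g] f j + f j *[g] (f i *[g] f i)
       = qint 2 *: (f i *[g] f j *[g] f i)) /\
  (1 < `|i%:Z - j%:Z| ->
     e i *[g] e j = e j *[g] e i /\ f i *[g] f j = f j *[g] f i) /\
  dp n.+1 *[g] dp i = dp i *[g] dp n.+1 /\
  (dp n.+1 *[g] dm n.+1 = one /\ dm n.+1 *[g] dp n.+1 = one) /\
  dp n.+1 *[g] e i *[g] dm n.+1 = vpow (- 2 * (n == i)%:Z) *: e i /\
  dp n.+1 *[g] f i *[g] dm n.+1 = vpow (2 * (n == i)%:Z) *: f i /\
  e n *[g] e n *[g] f n + f n *[g] (e n *[g] e n)
    = qint 2 *: (e n *[g] f n *[g] e n - e n *[g] t) /\
  f n *[g] f n *[g] e n + e n *[g] (f n *[g] f n)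
    = qint 2 *: (f n *[g] e n *[g] f n - t *[g] f n).
Proof.
cbv zeta => i j hi hj.
have hnn : (0 < n <= n)%N by rewrite hn leqnn.
have hn1 : (0 < n.+1 <= n.+1)%N by rewrite leqnn.
have hi1 := range_up hi; have hj1 := range_up hj; have hn2 := range_up hnn.
have hiS : (0 < i.+1 <= n.+1)%N by case/andP: hi.
(* Each side becomes [of_coef B] of a combination of coordinates; from here the field and the form
   may vary, although those of the statement are fixed. *)
rewrite !(eS_of_coef hB, fS_of_coef hB, dS_of_coef hB, dinvS_of_coef hB, oneS_of_coef n hB) //.
rewrite !(conv_of_coef hg hF hB, of_coefZ hB, of_coefD hB, of_coefB hB).
have lift (c c' : coef n d) : (forall (F : finFieldType) (hF : odd #|F|) (B : {symmetric 'rV[F]_(Ndim d)})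
     (hB : nondegenerate B) (v : rat), v != 0 -> v ^+ 2 = #|F|%:R ->
     specialize hB v c = specialize hB v c') -> of_coef B c = of_coef B c'.
  by move=> h; rewrite (specialize_faithful hg h).
(* The two neighbours of [i] need separate treatment, because their subspace counts are dual to each
   other. *)
have serre_cases (P : nat -> nat -> Prop) : (forall k, (0 < k)%N -> (k < n)%N -> P k k.+1) ->
    (forall k, (0 < k)%N -> (k < n)%N -> P k.+1 k) -> `|i%:Z - j%:Z| = 1 -> P i j.
  move=> next prev ij; have [i0 hi'] := andP hi; have [j0 hj'] := andP hj.
  have [ji|nij] := eqVneq j i.+1.
    by rewrite ji in hj' *; apply: next.
  have ij1 : i = j.+1 by move: ij nij; dimlia.
  by rewrite ij1 in hi' *; apply: prev.
have far : 1 < `|i%:Z - j%:Z| -> [/\ i <> j, i <> j.+1 & j <> i.+1].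
  by move=> ij; split=> E; move: ij; rewrite E; dimlia.
have weight_le a k : (a <= n)%N -> weight n a k = (a == k)%:Z - (a == k.+1)%:Z.
  move=> an; rewrite /weight; case: (eqVneq k n) => [->|_]; last by rewrite mulr1.
  by rewrite (ltn_eqF (an : (a < n.+1)%N)) mul0r.
have weight_last k : (k <= n)%N -> weight n n.+1 k = - 2 * (n == k)%:Z.
  by move=> kn; rewrite weightE; do ?case: eqP; move: kn; dimlia.
have [_ lein] := andP hi; have [_ lejn] := andP hj.
refine (conj (conj _ _) (conj _ (conj _ (conj _ (conj _ (conj _ (conj _ (conj _
  (conj (conj _ _) (conj _ (conj _ (conj _ _)))))))))))).
- by apply: lift => F' hF' B' hB' v v0 v2;
    rewrite (specialize_conv hg hF' hB' v0 v2) specialize_dS // specialize_dinvS //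
      (specialize_one n hB' v0) KKinv_op.
- by apply: lift => F' hF' B' hB' v v0 v2;
    rewrite (specialize_conv hg hF' hB' v0 v2) specialize_dS // specialize_dinvS //
      (specialize_one n hB' v0) KinvK_op.
- apply: lift => F' hF' B' hB' v v0 v2; rewrite !(specialize_conv hg hF' hB' v0 v2).
  by rewrite !specialize_dS // K_opC.
- apply: lift => F' hF' B' hB' v v0 v2.
  rewrite !(specialize_conv hg hF' hB' v0 v2) (specializeZ hB' v0).
  rewrite specialize_dS // specialize_dinvS // (specialize_e hB' v0) // (laurent_eval_vpow v0).
  by rewrite K_conj_e // weight_le.
- apply: lift => F' hF' B' hB' v v0 v2.
  rewrite !(specialize_conv hg hF' hB' v0 v2) (specializeZ hB' v0).
  rewrite specialize_dS // specialize_dinvS // (specialize_f hB' v0) // (laurent_eval_vpow v0).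
  by rewrite K_conj_f // weight_le // opprB addrC.
- move=> /eqP ne_in /eqP ne_jn; apply: lift => F' hF' B' hB' v v0 v2.
  have hin : (0 < i < n)%N by case/andP: hi => -> _; rewrite ltn_neqAle ne_in.
  have hjn : (0 < j < n)%N by case/andP: hj => -> _; rewrite ltn_neqAle ne_jn.
  rewrite !(specializeZ hB' v0) !specializeB // !(specialize_conv hg hF' hB' v0 v2).
  rewrite (specialize_e hB' v0 hi) (specialize_f hB' v0 hj).
  rewrite (specialize_dS hB' v0 hi1) (specialize_dS hB' v0 hiS).
  rewrite (specialize_dinvS hB' v0 hi1) (specialize_dinvS hB' v0 hiS).
  rewrite (laurent_eval_v_subV v0) (laurent_eval_nat v0).
  case: (eqVneq i j) => [ij|/eqP nij].
    by rewrite -ij scale1r ef_same.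
  by rewrite (ef_comm v0 hB' hin hjn nij) subrr scaler0 scale0r.
- move=> ij; split; apply: lift => F' hF' B' hB' v v0 v2.
  rewrite (specializeD hB' v0) (specializeZ hB' v0) !(specialize_conv hg hF' hB' v0 v2).
  rewrite !(specialize_e hB' v0) // (laurent_eval_qint2 v0); move: ij.
  pose x := e_op n B' v.
  apply: (serre_cases (fun a b =>
    x a *m x a *m x b + x b *m (x a *m x a) = (v + v^-1) *: (x a *m x b *m x a))) => k k0 kn.
    exact: (e_serre_next v0 v2 hB' k0 kn).
  exact: (e_serre_prev v0 v2 hB' k0 kn).
  rewrite (specializeD hB' v0) (specializeZ hB' v0) !(specialize_conv hg hF' hB' v0 v2).
  rewrite !(specialize_f hB' v0) // (laurent_eval_qint2 v0); move: ij.
  pose x := f_op n B' v.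
  apply: (serre_cases (fun a b =>
    x a *m x a *m x b + x b *m (x a *m x a) = (v + v^-1) *: (x a *m x b *m x a))) => k k0 kn.
    exact: (f_serre_next v0 v2 hB' k0 kn).
  exact: (f_serre_prev v0 v2 hB' k0 kn).
- move=> /far[ij ij1 ji1]; split; apply: lift => F' hF' B' hB' v v0 v2.
  by rewrite !(specialize_conv hg hF' hB' v0 v2) !(specialize_e hB' v0) // e_comm.
  by rewrite !(specialize_conv hg hF' hB' v0 v2) !(specialize_f hB' v0) // f_comm.
- apply: lift => F' hF' B' hB' v v0 v2; rewrite !(specialize_conv hg hF' hB' v0 v2).
  by rewrite !specialize_dS // K_opC.
- by apply: lift => F' hF' B' hB' v v0 v2;
    rewrite (specialize_conv hg hF' hB' v0 v2) specialize_dS // specialize_dinvS //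
      (specialize_one n hB' v0) KKinv_op.
- by apply: lift => F' hF' B' hB' v v0 v2;
    rewrite (specialize_conv hg hF' hB' v0 v2) specialize_dS // specialize_dinvS //
      (specialize_one n hB' v0) KinvK_op.
- apply: lift => F' hF' B' hB' v v0 v2.
  rewrite !(specialize_conv hg hF' hB' v0 v2) (specializeZ hB' v0).
  rewrite specialize_dS // specialize_dinvS // (specialize_e hB' v0) // (laurent_eval_vpow v0).
  by rewrite K_conj_e // weight_last.
- apply: lift => F' hF' B' hB' v v0 v2.
  rewrite !(specialize_conv hg hF' hB' v0 v2) (specializeZ hB' v0).
  rewrite specialize_dS // specialize_dinvS // (specialize_f hB' v0) // (laurent_eval_vpow v0).
  by rewrite K_conj_f // weight_last // mulNr opprK.
- apply: lift => F' hF' B' hB' v v0 v2.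
  rewrite (specializeD hB' v0) (specializeZ hB' v0) specializeB // !(specialize_conv hg hF' hB' v0 v2).
  rewrite (specializeD hB' v0) !(specializeZ hB' v0) !(specialize_conv hg hF' hB' v0 v2).
  rewrite (specialize_e hB' v0 hnn) (specialize_f hB' v0 hnn).
  rewrite (specialize_dS hB' v0 hn2) (specialize_dS hB' v0 hn1).
  rewrite (specialize_dinvS hB' v0 hn2) (specialize_dinvS hB' v0 hn1).
  by rewrite (laurent_eval_qint2 v0) !(laurent_eval_vpow v0) expr1z exprN1 e_last.
- apply: lift => F' hF' B' hB' v v0 v2.
  rewrite (specializeD hB' v0) (specializeZ hB' v0) specializeB // !(specialize_conv hg hF' hB' v0 v2).
  rewrite (specializeD hB' v0) !(specializeZ hB' v0) !(specialize_conv hg hF' hB' v0 v2).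
  rewrite (specialize_e hB' v0 hnn) (specialize_f hB' v0 hnn).
  rewrite (specialize_dS hB' v0 hn2) (specialize_dS hB' v0 hn1).
  rewrite (specialize_dinvS hB' v0 hn2) (specialize_dinvS hB' v0 hn1).
  by rewrite (laurent_eval_qint2 v0) !(laurent_eval_vpow v0) expr1z exprN1 f_last.
Qed.
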